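(* Let $A$ be a $C^*$-algebra and let $p\in[1,\infty)\setminus\{2\}$. Then $A$ admits an isometric representation on an $L^p$-space if and only if $A$ is commutative.
   Context: A representation is a bounded linear multiplicative map into the bounded operators on a Banach space; an $L^p$-space means $L^p(\mu)$ for some measure space. *)

(* Defs.v *)
(* Complex numbers are R[i] (mathcomp-real-closed)
   over an arbitrary realType R (any realType is isomorphic to the reals). *)
From HB Require Import structures.
From mathcomp Require Import all_boot all_order all_algebra.
From mathcomp Require Import all_classical all_reals all_analysis.
From mathcomp Require Import complex.
Set Implicit Arguments. Unset Strict Implicit. Unset Printing Implicit Defensive.
Import Order.TTheory GRing.Theory Num.Theory.
Local Open Scope classical_set_scope.
Local Open Scope ring_scope.

(* modulus of a complex number *)
Definition cmod (R : realType) (z : R[i]) : R := ComplexField.Normc.normc z.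

(** * C*-algebras
    A (possibly non-unital) C*-algebra: a complex vector space [A] with an
    associative bilinear product [mul], a norm [nrm] for which [A] is complete
    (Banach), submultiplicative, an involution [star] (conjugate linear,
    anti-multiplicative) satisfying the C*-identity. *)
Definition is_cstar_algebra (R : realType) (A : lmodType R[i])
    (mul : A -> A -> A) (star : A -> A) (nrm : A -> R) : Prop :=
  (* associative algebra *)
  [/\ (forall a b c, mul a (mul b c) = mul (mul a b) c),
      (forall a b c, mul (a + b) c = mul a c + mul b c /\
                     mul a (b + c) = mul a b + mul a c) &
      (forall (k : R[i]) a b, mul (k *: a) b = k *: mul a b /\
                              mul a (k *: b) = k *: mul a b)] /\
  (* norm *)
  [/\ forall a, nrm a = 0 -> a = 0,
      forall (k : R[i]) a, nrm (k *: a) = cmod k * nrm a &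
      forall a b, nrm (a + b) <= nrm a + nrm b] /\
  (* completeness *)
  (forall u : nat -> A,
      (forall e : R, 0 < e -> exists N, forall m n,
          (N <= m)%N -> (N <= n)%N -> nrm (u m - u n) < e) ->
      exists l, forall e : R, 0 < e -> exists N, forall n,
          (N <= n)%N -> nrm (u n - l) < e) /\
  (* submultiplicativity *)
  (forall a b, nrm (mul a b) <= nrm a * nrm b) /\
  (* involution *)
  [/\ forall a b, star (a + b) = star a + star b,
      forall (k : R[i]) a, star (k *: a) = (k^*)%C *: star a,
      forall a, star (star a) = a &
      forall a b, star (mul a b) = mul (star b) (star a)] /\
  (* C*-identity *)
  (forall a, nrm (mul (star a) a) = nrm a ^+ 2).

Definition commutative_alg (A : Type) (mul : A -> A -> A) : Prop :=
  forall a b, mul a b = mul b a.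

(** * Complex L^p(mu) *)
Section Lp.
Context (R : realType) (d : measure_display) (T : measurableType d)
  (mu : {measure set T -> \bar R}) (p : R).

(* the L^p (semi)norm of a complex-valued function *)
Definition cLpnorm (f : T -> R[i]) : \bar R :=
  Lnorm mu p%:E (fun x => (cmod (f x))%:E).

(* f is (a representative of) an element of L^p(mu) *)
Definition cLp (f : T -> R[i]) : Prop :=
  [/\ measurable_fun setT (fun x => complex.Re (f x)),
      measurable_fun setT (fun x => complex.Im (f x)) &
      (cLpnorm f < +oo)%E].

(* S induces a bounded linear operator on L^p(mu) (elements of L^p being
   a.e.-classes of functions) *)
Definition Lp_bounded_operator (S : (T -> R[i]) -> (T -> R[i])) : Prop :=
  [/\ forall f, cLp f -> cLp (S f),
      forall f g, cLp f -> cLp g -> {ae mu, forall x, f x = g x} ->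
                  {ae mu, forall x, S f x = S g x},
      forall (k : R[i]) f g, cLp f -> cLp g ->
        {ae mu, forall x, S (fun y => k * f y + g y) x = k * S f x + S g x} &
      exists M : R, forall f, cLp f -> (cLpnorm (S f) <= M%:E * cLpnorm f)%E].

(* operator norm *)
Definition Lp_opnorm (S : (T -> R[i]) -> (T -> R[i])) : \bar R :=
  ereal_sup [set cLpnorm (S f) | f in [set f | cLp f /\ (cLpnorm f <= 1)%E]].

(* an isometric representation of (A, mul, nrm) on L^p(mu): a linear,
   multiplicative map into the bounded operators on L^p(mu) preserving norms *)
Definition isometric_Lp_rep (A : lmodType R[i]) (mul : A -> A -> A)
    (nrm : A -> R) (pi : A -> (T -> R[i]) -> (T -> R[i])) : Prop :=
  [/\ forall a, Lp_bounded_operator (pi a),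
      forall (k : R[i]) a b f, cLp f ->
        {ae mu, forall x, pi (k *: a + b) f x = k * pi a f x + pi b f x},
      forall a b f, cLp f ->
        {ae mu, forall x, pi (mul a b) f x = pi a (pi b f) x} &
      forall a, Lp_opnorm (pi a) = (nrm a)%:E].
End Lp.

(* A admits an isometric representation on some L^p-space *)
Definition has_isometric_Lp_rep (R : realType) (p : R) (A : lmodType R[i])
    (mul : A -> A -> A) (nrm : A -> R) : Prop :=
  exists (d : measure_display) (T : measurableType d)
         (mu : {measure set T -> \bar R}) (pi : A -> (T -> R[i]) -> (T -> R[i])),
    isometric_Lp_rep mu p mul nrm pi.

(* Main.v *)
(* If the algebra is commutative, its norm satisfies |a^2| = |a|^2.  Zorn's lemma
   gives, for each a, a minimal such seminorm taking the value |a| at a;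
   minimality makes it multiplicative, and by Ostrowski's form of the
   Gelfand-Mazur theorem it is the modulus of a character.  Multiplication by
   these characters is an isometric representation on a discrete l^p-space.

   Conversely, let the algebra be represented on L^p with p <> 2.  If a, b are
   self-adjoint with a b = 0, then functions f in the range of a and g in the
   range of b have disjoint supports: with approximate units u, v of a and b the
   contractions u + w v (|w| = 1) and convexity show that h = 0 minimizes the
   sum over z^4 = 1 of |f + z g + h / z|_p^p, whereas a second order expansion
   shows that h = eps * f * conj (g / f) decreases the integrand as soon as
   0 < |g| << |f|.  For an element x of square zero, the disjointness of the
   ranges for two pairs of orthogonal elements of the cone over the 2x2 matrices
   generated by x forces x = 0.  Finally, a C*-algebra without nilpotents is
   commutative: cutting the positive part c of a self-adjoint element into n
   ramps c_j of height 1/n, the elements c_j y (1/n - c_k) have square zero for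
   k < j, hence vanish, and the double commutator [c, [c, y]] collapses to the
   sum of the [c_j, [c_j, y]], which is O(1/n). *)
Require Import Defs.
From HB Require Import structures.
From mathcomp Require Import all_boot all_order all_algebra.
From mathcomp Require Import all_classical all_reals all_analysis.
From mathcomp Require Import measurable_realfun complex.
From mathcomp Require Import ring lra.
Import Order.TTheory GRing.Theory Num.Theory.
Set Implicit Arguments. Unset Strict Implicit. Unset Printing Implicit Defensive.
Local Open Scope classical_set_scope.
Local Open Scope ring_scope.

(** The characters built for the commutative case serve a second time. Applied to the polynomials
    without constant term in one self-adjoint element of norm at most 1, they show that the norm of
    such a polynomial is its modulus at some real point of [-1, 1]. This yields the functional
    calculus behind the approximate units and the ramps of the converse. The algebra need not have a
    unit, hence every function of an element b vanishes at 0 and is approximated by s P(s), realized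
    as P(b) b.

    The exclusion of p = 2 comes from r = p / 2: averaging over the fourth roots of unity removes
    the terms of odd order, and the best eps, (1 - r) / r, gains 4 (r - 1)^2 |g / f|^2 relative to
    |f|^p. The estimate needs |g| small against |f|, but g may be replaced by g / (n + 1), so
    countably many null sets give disjoint supports.

    For an element of square zero, disjointness is used three times and gives u v = u2 v = (u + v)
    (u2 - v) = 0 for three functions, whence v^3 = 0. *)

Section Modulus.
Context {R : realType}.
Implicit Types z w : R[i].

Lemma cmodM z w : cmod (z * w) = cmod z * cmod w.
Proof. exact: ComplexField.Normc.normcM. Qed.

Lemma cmodD z w : cmod (z + w) <= cmod z + cmod w.
Proof. exact: le_normcD. Qed.

Lemma cmodN z : cmod (- z) = cmod z.
Proof. exact: normcN. Qed.

Lemma cmodB z w : cmod (z - w) <= cmod z + cmod w.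
Proof. by rewrite (le_trans (cmodD _ _))// cmodN. Qed.

Lemma cmod_ge0 z : 0 <= cmod z.
Proof. by case: z => a b; rewrite /cmod /= sqrtr_ge0. Qed.

Lemma cmod0 : cmod (0 : R[i]) = 0.
Proof. exact: ComplexField.Normc.normc0. Qed.

Lemma cmod1 : cmod (1 : R[i]) = 1.
Proof. exact: ComplexField.Normc.normc1. Qed.

Lemma cmod_eq0 z : cmod z = 0 -> z = 0.
Proof. exact: ComplexField.Normc.eq0_normc. Qed.

Lemma cmodV z : cmod z^-1 = (cmod z)^-1.
Proof. exact: ComplexField.Normc.normcV. Qed.

Lemma cmodX z n : cmod (z ^+ n) = cmod z ^+ n.
Proof. by elim: n => [|n IH]; rewrite ?cmod1// !exprS cmodM IH. Qed.

Lemma cmod_real (a : R) : cmod a%:C%C = `|a|.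
Proof. by rewrite /cmod /= expr0n /= addr0 sqrtr_sqr. Qed.

Lemma cmod_sqr z : cmod z ^+ 2 = complex.Re z ^+ 2 + complex.Im z ^+ 2.
Proof. by case: z => a b; rewrite /cmod /= sqr_sqrtr// addr_ge0// sqr_ge0. Qed.

Lemma cmod_conj z : cmod (z^*)%C = cmod z.
Proof. by case: z => a b; rewrite /cmod /= sqrrN. Qed.

End Modulus.

(** * Characters of commutative algebras with a power multiplicative norm *)

Section PowerMultiplicative.
Context {R : realType} {K : lmodType R[i]} (mul : K -> K -> K).
Context (mulA : forall a b c, mul a (mul b c) = mul (mul a b) c).
Context (mulC : forall a b, mul a b = mul b a).
Context (mulDl : forall a b c, mul (a + b) c = mul a c + mul b c).
Context (mulZl : forall k a b, mul (k *: a) b = k *: mul a b).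

Definition power_mult_seminorm (N : K -> R) : Prop :=
  [/\ forall x y, N (x + y) <= N x + N y,
      forall k x, N (k *: x) = cmod k * N x,
      forall x y, N (mul x y) <= N x * N y &
      forall x, N (mul x x) = N x ^+ 2].

Definition seminorm_mult_at (c : R) (a : K) (N : K -> R) : Prop :=
  forall y, c * N y <= N (mul a y).

Lemma seminorm_ge0 (N : K -> R) : (forall x y, N (x + y) <= N x + N y) ->
  (forall k x, N (k *: x) = cmod k * N x) -> forall x, 0 <= N x.
Proof.
move=> ND NZ x; have := ND x (- 1 *: x).
rewrite NZ cmodN cmod1 mul1r scaleN1r subrr -(scale0r (0 : K)) NZ cmod0 mul0r.
by rewrite -mulr2n pmulrn_lge0.
Qed.

Section Smear.
Context (N : K -> R) (NP : power_mult_seminorm N) (f : K) (Nf : 0 < N f).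

Let N_ge0 x : 0 <= N x.
Proof. by case: NP => ND NZ _ _; exact: seminorm_ge0. Qed.

Fixpoint sq_iter k := if k is k'.+1 then mul (sq_iter k') (sq_iter k') else f.

Let N_sq_iter_gt0 k : 0 < N (sq_iter k).
Proof. by case: NP => _ _ _ N2; elim: k => //= k IH; rewrite N2 exprn_gt0. Qed.

(* [N (a f^n) / N (f)^n] along [n = 2^k], where [N (f^n) = N (f)^n] holds. *)
Definition smear_seq (a : K) (k : nat) := N (mul a (sq_iter k)) / N (sq_iter k).

Let smear_seq_ge0 a k : 0 <= smear_seq a k.
Proof. by rewrite divr_ge0. Qed.

Let smear_seqS a k : smear_seq a k.+1 <= smear_seq a k.
Proof.
case: NP => _ _ NM N2; rewrite /smear_seq /= N2 mulA.
rewrite ler_pdivrMr ?exprn_gt0// (le_trans (NM _ _))//.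
by rewrite expr2 mulrA divfK// gt_eqF.
Qed.

Let smear_seq_le a k l : (k <= l)%N -> smear_seq a l <= smear_seq a k.
Proof.
move=> /subnK <-; elim: (l - k)%N => //= n IH.
by rewrite addSn (le_trans (smear_seqS _ _)).
Qed.

(** The sequence is nonincreasing, so the infimum is its limit. Multiplying by high powers of [f]
    and renormalizing is what makes the result multiplicative at [f]. *)
Definition smear (a : K) := inf (range (smear_seq a)).

Let smear_lb a : has_lbound (range (smear_seq a)).
Proof. by exists 0 => _ [k _ <-]. Qed.

Let smear_le a k : smear a <= smear_seq a k.
Proof. by apply: ge_inf => //; exists k. Qed.

Let smear_ge a c : (forall k, c <= smear_seq a k) -> c <= smear a.
Proof.
move=> H; apply: lb_le_inf; first by exists (smear_seq a 0), 0%N.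
by move=> _ [k _ <-].
Qed.

Let smear_ge0 a : 0 <= smear a. Proof. exact: smear_ge. Qed.

Let smear_adherent a e : 0 < e ->
  exists k, forall l, (k <= l)%N -> smear_seq a l < smear a + e.
Proof.
move=> e0; have [|_ [k _ <-] Hk] := @inf_adherent _ (range (smear_seq a)) e e0.
  by split => //; exists (smear_seq a 0), 0%N.
by exists k => l kl; apply: le_lt_trans Hk; exact: smear_seq_le.
Qed.

Lemma smear_le_base a : smear a * N f <= N (mul a f).
Proof. by rewrite -ler_pdivlMr// (smear_le a 0). Qed.

Lemma smear_le_seminorm a : smear a <= N a.
Proof.
rewrite (le_trans (smear_le a 0))// /smear_seq /= ler_pdivrMr//.
by case: NP => _ _ NM _; exact: NM.
Qed.

Let smear_seqD a b k : smear_seq (a + b) k <= smear_seq a k + smear_seq b k.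
Proof.
case: NP => ND _ _ _; rewrite /smear_seq mulDl -mulrDl ler_pM2r ?invr_gt0//.
Qed.

Let smear_seqZ z a k : smear_seq (z *: a) k = cmod z * smear_seq a k.
Proof. by case: NP => _ NZ _ _; rewrite /smear_seq mulZl NZ mulrA. Qed.

Let smear_seqM a b k :
  smear_seq (mul a b) k.+1 <= smear_seq a k * smear_seq b k.
Proof.
case: NP => _ _ NM N2; rewrite /smear_seq /= N2.
(* The index [k.+1] doubles the power of [f], which leaves one factor [sq_iter k] for [a] and one
   for [b]. *)
have -> : mul (mul a b) (mul (sq_iter k) (sq_iter k)) =
  mul (mul a (sq_iter k)) (mul b (sq_iter k)).
  by rewrite -!mulA; congr mul; rewrite !mulA (mulC b).
rewrite mulf_div -expr2 ler_pM2r ?invr_gt0 ?exprn_gt0//.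
Qed.

Let smear_seq_sqr a k : smear_seq (mul a a) k.+1 = smear_seq a k ^+ 2.
Proof.
case: NP => _ _ _ N2; rewrite /smear_seq /= N2 expr_div_n -[X in _ = X / _]N2.
by congr (N _ / _); rewrite -!mulA; congr mul; rewrite !mulA (mulC a).
Qed.

Let smear_geZ z a : cmod z * smear a <= smear (z *: a).
Proof. by apply: smear_ge => k; rewrite smear_seqZ ler_wpM2l ?cmod_ge0. Qed.

Lemma smear_power_mult : power_mult_seminorm smear.
Proof.
have smearM x y : smear (mul x y) <= smear x * smear y.
  apply/ler_addgt0Pr => e e0.
  pose d := Num.min 1 (e / (smear x + smear y + 1)).
  have s0 : 0 < smear x + smear y + 1 by rewrite ltr_wpDl// addr_ge0.
  have d0 : 0 < d by rewrite lt_min ltr01 divr_gt0.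
  have [k Hk] := smear_adherent x d0; have [l Hl] := smear_adherent y d0.
  apply: (le_trans (smear_le _ (maxn k l).+1)).
  apply: (le_trans (smear_seqM _ _ _)).
  have /ltW Hk' := Hk _ (leq_maxl k l); have /ltW Hl' := Hl _ (leq_maxr k l).
  apply: (le_trans (ler_pM _ _ Hk' Hl')) => //.
  have d1 : d <= 1 by rewrite ge_min lexx.
  have d2 : d * (smear x + smear y + 1) <= e.
    by rewrite -ler_pdivlMr// ge_min lexx orbT.
  have := smear_ge0 x; have := smear_ge0 y; nra.
split => //.
- move=> x y; apply/ler_addgt0Pr => e e0.
  have e20 : 0 < e / 2 by rewrite divr_gt0.
  have [k Hk] := smear_adherent x e20; have [l Hl] := smear_adherent y e20.
  apply: (le_trans (smear_le _ (maxn k l))).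
  apply: (le_trans (smear_seqD _ _ _)).
  have := Hk _ (leq_maxl k l); have := Hl _ (leq_maxr k l); lra.
- move=> z x; apply/eqP; rewrite eq_le smear_geZ andbT.
  have [->|z0] := eqVneq z 0.
    rewrite cmod0 mul0r (le_trans (smear_le _ 0))//.
    by rewrite smear_seqZ cmod0 mul0r.
  have cz0 : 0 < cmod z.
    by rewrite lt_def cmod_ge0 andbT; apply: contra_neq z0 => /cmod_eq0.
  rewrite -ler_pdivrMl// -cmodV (le_trans (smear_geZ _ _))//.
  by rewrite scalerA mulVf// scale1r.
- move=> x; apply/eqP; rewrite eq_le {1}expr2 smearM/=.
  apply: smear_ge => k; apply: le_trans (smear_seqS _ _).
  by rewrite smear_seq_sqr lerXn2r ?nnegrE.
Qed.

(** Induction: squaring the power of [f] multiplies the left side by at most [N (sq_iter k)], and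
    the right side by exactly that. *)
Let sq_iter_growth y k : N f * N (mul y (sq_iter k)) <= N (mul y f) * N (sq_iter k).
Proof.
case: NP => _ _ NM N2; elim: k => [|k IH]; first by rewrite mulrC.
rewrite /= mulA N2 (le_trans (ler_wpM2l (N_ge0 _) (NM _ _)))//.
by rewrite mulrA expr2 mulrA ler_wpM2r.
Qed.

(** With n = 2^k, [sq_iter_growth] at y f^n compares y f^(2n) with y f^(n+1). Hence term k of the
    sequence for [mul f y] is at least [N f] times term k+1 of the sequence for y. *)
Lemma smear_mult_base : seminorm_mult_at (N f) f smear.
Proof.
move=> y; apply: smear_ge => k.
apply: (le_trans (ler_wpM2l (N_ge0 _) (smear_le y k.+1))).
case: NP => _ _ NM N2; rewrite /smear_seq /= N2 mulrA ler_pdivrMr ?exprn_gt0//.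
rewrite expr2 mulrA divfK ?gt_eqF// mulA (le_trans (sq_iter_growth _ _))//.
by rewrite (mulC f) -!mulA (mulC f).
Qed.

Lemma smear_base : smear f = N f.
Proof.
apply/eqP; rewrite eq_le smear_le_seminorm/=; apply: smear_ge => k.
case: NP => _ _ NM N2; rewrite ler_pdivlMr// (mulC f).
have := sq_iter_growth (sq_iter k) k.
by rewrite N2 expr2 mulrA ler_pM2r.
Qed.

Lemma smear_mult_at c a : seminorm_mult_at c a N -> seminorm_mult_at c a smear.
Proof.
move=> H y; have [c0|/ltW c0] := leP 0 c; last first.
  by rewrite (le_trans _ (smear_ge0 _))// mulr_le0_ge0.
apply: smear_ge => k; rewrite (le_trans (ler_wpM2l c0 (smear_le y k)))//.
by rewrite mulrA ler_pM2r ?invr_gt0// -mulA H.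
Qed.

Lemma smear_keep c a : seminorm_mult_at c a N -> c <= smear a.
Proof. by move=> H; apply: smear_ge => k; rewrite ler_pdivlMr// H. Qed.

End Smear.
End PowerMultiplicative.

Section MultiplicativeSeminorm.
Context {R : realType} {K : lmodType R[i]} (mul : K -> K -> K).
Context (mulA : forall a b c, mul a (mul b c) = mul (mul a b) c).
Context (mulC : forall a b, mul a b = mul b a).
Context (mulDl : forall a b c, mul (a + b) c = mul a c + mul b c).
Context (mulZl : forall k a b, mul (k *: a) b = k *: mul a b).

(** The constant in the multiplicativity at [a] stays [nu a] while [N] is lowered. By [smear_keep]
    this prevents smearing along another element from lowering the value at [a], so the class is
    stable under smearing. *)
Definition localized_seminorm (nu : K -> R) (a : K) (N : K -> R) : Prop :=
  [/\ power_mult_seminorm mul N, seminorm_mult_at mul (nu a) a N, N a = nu a &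
      forall x, N x <= nu x].

Lemma minimal_localized_seminorm (nu : K -> R) (a : K) :
  (exists N, localized_seminorm nu a N) ->
  exists N, localized_seminorm nu a N /\
    forall M, localized_seminorm nu a M -> (forall x, M x <= N x) -> M = N.
Proof.
move=> [N0 PN0]; pose S := {N | localized_seminorm nu a N}.
pose rel (s t : S) := `[< forall x, sval t x <= sval s x >].
have S_ge0 (s : S) x : 0 <= sval s x.
  by have [[ND NZ _ _] _ _ _] := svalP s; exact: seminorm_ge0.
have chain (C : set S) : total_on C rel -> exists t, forall s, C s -> rel s t.
  move=> totC; have [[s0 Cs0]|C0] := pselect (exists s, C s); last first.
    by exists (exist _ N0 PN0) => s Cs; exfalso; apply: C0; exists s.
  pose E x := [set sval s x | s in C].
  pose m x := inf (E x).
  have mle s x : C s -> m x <= sval s x.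
    by move=> Cs; apply: ge_inf; [exists 0 => _ [t _ <-]|exists s].
  have mge x d : (forall s, C s -> d <= sval s x) -> d <= m x.
    move=> H; apply: lb_le_inf; first by exists (sval s0 x), s0.
    by move=> _ [s Cs <-]; exact: H.
  have madh x e : 0 < e -> exists2 s, C s & sval s x < m x + e.
    move=> e0; have [|_ [s Cs <-] H] := @inf_adherent _ (E x) e e0.
      by split; [exists (sval s0 x), s0|exists 0 => _ [t _ <-]].
    by exists s.
  (* Of two near-minimizers in a chain, the smaller seminorm serves at both points. This lets the
     infimum inherit inequalities that involve two elements. *)
  have m2 x y e : 0 < e -> exists s,
      [/\ C s, sval s x < m x + e & sval s y < m y + e].
    move=> e0; have [s Cs Hs] := madh x e e0; have [t Ct Ht] := madh y e e0.
    have [/asboolP st|/asboolP ts] := totC _ _ Cs Ct.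
      by exists t; split => //; exact: le_lt_trans (st x) Hs.
    by exists s; split => //; exact: le_lt_trans (ts y) Ht.
  have m_ge0 x : 0 <= m x by apply: mge.
  have mM x y : m (mul x y) <= m x * m y.
    apply/ler_addgt0Pr => e e0.
    pose d := Num.min 1 (e / (m x + m y + 1)).
    have s_gt0 : 0 < m x + m y + 1 by rewrite ltr_wpDl// addr_ge0.
    have d0 : 0 < d by rewrite lt_min ltr01 divr_gt0.
    have [s [Cs /ltW Hx /ltW Hy]] := m2 x y d d0.
    apply: (le_trans (mle s _ Cs)).
    have [[_ _ NM _] _ _ _] := svalP s.
    rewrite (le_trans (NM _ _))// (le_trans (ler_pM _ _ Hx Hy))//.
    have d1 : d <= 1 by rewrite ge_min lexx.
    have d2 : d * (m x + m y + 1) <= e.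
      by rewrite -ler_pdivlMr// ge_min lexx orbT.
    have := m_ge0 x; have := m_ge0 y; nra.
  have mZ z x : cmod z * m x <= m (z *: x).
    apply: mge => s Cs; have [[_ NZ _ _] _ _ _] := svalP s.
    by rewrite NZ ler_wpM2l ?cmod_ge0// mle.
  suff Pm : localized_seminorm nu a m by exists (exist _ m Pm) => s Cs; apply/asboolP => x /=; exact: mle.
  split; first split.
  - move=> x y; apply/ler_addgt0Pr => e e0.
    have [|s [Cs Hx Hy]] := m2 x y (e / 2); first by rewrite divr_gt0.
    have [[ND _ _ _] _ _ _] := svalP s.
    by have := mle s (x + y) Cs; have := ND x y; lra.
  - move=> z x; apply/eqP; rewrite eq_le mZ andbT.
    have [->|z0] := eqVneq z 0.
      rewrite cmod0 mul0r (le_trans (mle s0 _ Cs0))//.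
      by have [[_ NZ _ _] _ _ _] := svalP s0; rewrite NZ cmod0 mul0r.
    have cz0 : 0 < cmod z.
      by rewrite lt_def cmod_ge0 andbT; apply: contra_neq z0 => /cmod_eq0.
    rewrite -ler_pdivrMl// -cmodV (le_trans (mZ _ _))//.
    by rewrite scalerA mulVf// scale1r.
  - exact: mM.
  - move=> x; apply/eqP; rewrite eq_le {1}expr2 mM/=; apply: mge => s Cs.
    have [[_ _ _ N2] _ _ _] := svalP s.
    by rewrite N2 lerXn2r ?nnegrE// mle.
  - move=> y; apply: mge => s Cs; have [_ Na Nc _] := svalP s.
    have c0 : 0 <= nu a by rewrite -Nc.
    by rewrite (le_trans _ (Na y))// ler_wpM2l// mle.
  - apply/eqP; rewrite eq_le; apply/andP; split.
      by rewrite (le_trans (mle s0 _ Cs0))//; have [_ _ -> _] := svalP s0.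
    by apply: mge => s Cs; have [_ _ -> _] := svalP s.
  - by move=> x; rewrite (le_trans (mle s0 _ Cs0))//; have [_ _ _ ->] := svalP s0.
have [||||[N PN] minN] := @Zorn S rel.
- by move=> s; apply/asboolP => x.
- move=> r s t /asboolP rs /asboolP st; apply/asboolP => x.
  exact: le_trans (st x) (rs x).
- move=> [s Ps] [t Pt] /asboolP/= st /asboolP/= ts; apply: eq_exist => /=.
  by apply/funext => x; apply/eqP; rewrite eq_le st ts.
- exact: chain.
exists N; split => // M PM MN.
by apply: (congr1 sval (minN (exist _ M PM) _)); apply/asboolP.
Qed.

(** Smearing a minimal [N] along y stays in the class and lies below [N], hence returns [N]; then
    [smear_le_base] is the missing inequality N x N y <= N (x y). *)
Lemma multiplicative_seminorm (nu : K -> R) (a : K) :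
  power_mult_seminorm mul nu -> 0 < nu a ->
  exists N : K -> R, [/\ power_mult_seminorm mul N, forall x, N x <= nu x,
    N a = nu a & forall x y, N (mul x y) = N x * N y].
Proof.
move=> nuP nua.
have [|N [[NP Na Nc Nle] minN]] := @minimal_localized_seminorm nu a.
  exists (smear mul nu a); split; [exact: smear_power_mult|exact: smear_mult_base|
    exact: smear_base|exact: smear_le_seminorm].
exists N; split => //.
have N_ge0 x : 0 <= N x by case: NP => ND NZ _ _; exact: seminorm_ge0.
have NM x y : N (mul x y) <= N x * N y by case: NP.
move=> x y; apply/eqP; rewrite eq_le NM/=.
have [Ny0|Ny] := eqVneq (N y) 0; first by rewrite Ny0 mulr0.
have {}Ny : 0 < N y by rewrite lt_def Ny N_ge0.
suff E : smear mul N y = N by rewrite -{1}E; exact: smear_le_base.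
apply: minN; last by move=> z; exact: smear_le_seminorm.
split; [exact: smear_power_mult|exact: smear_mult_at| |].
  apply/eqP; rewrite eq_le -{1}Nc smear_le_seminorm//=.
  exact: smear_keep.
by move=> z; rewrite (le_trans _ (Nle z))// smear_le_seminorm.
Qed.

End MultiplicativeSeminorm.

Lemma exprD_le {R : realFieldType} (m : R) n (e : R) : 0 < m -> 0 < e ->
  exists2 d, 0 < d & (m + d) ^+ n <= m ^+ n + e.
Proof.
move=> m0; elim: n e => [|n IH] e e0; first by exists 1 => //; rewrite !expr0; lra.
have [|d d0 Hd] := IH (e / (2 * (m + 1))); first by rewrite divr_gt0//; lra.
have mn : 0 < m ^+ n by rewrite exprn_gt0.
pose d' := Num.min (Num.min d 1) (e / (2 * (m ^+ n + 1))).
have h0 : 0 < e / (2 * (m ^+ n + 1)) by rewrite divr_gt0//; lra.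
exists d'; first by rewrite !lt_min d0 ltr01 h0.
have d'0 : 0 < d' by rewrite !lt_min d0 ltr01 h0.
have d'd : d' <= d by rewrite !ge_min lexx.
have d'1 : d' <= 1 by rewrite !ge_min lexx orbT.
have d'2 : d' * (2 * (m ^+ n + 1)) <= e.
  by rewrite -ler_pdivlMr ?ge_min ?lexx ?orbT//; lra.
have {}Hd : (m + d') ^+ n <= m ^+ n + e / (2 * (m + 1)).
  by rewrite (le_trans _ Hd)// lerXn2r ?nnegrE; lra.
have E : e / (2 * (m + 1)) * (2 * (m + 1)) = e by rewrite divfK//; lra.
move: Hd E; set u := e / _ => Hd E.
have u0 : 0 < u by rewrite divr_gt0//; lra.
rewrite !exprS (le_trans (ler_wpM2l _ Hd)); [by []|lra|nra].
Qed.

(** * Ostrowski's form of the Gelfand-Mazur theorem *)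

Section GelfandMazur.
Context {R : realType} (Q : {poly R[i]} -> R).
Context (QM : forall p q, Q (p * q) = Q p * Q q).
Context (QD : forall p q, Q (p + q) <= Q p + Q q).
Context (QC : forall c : R[i], Q c%:P = cmod c).

Let QN p : Q (- p) = Q p.
Proof. by rewrite -mulN1r QM -polyCN QC cmodN cmod1 mul1r. Qed.

Let Q_ge0 p : 0 <= Q p.
Proof.
have := QD p (- p).
by rewrite subrr QN QC cmod0 -mulr2n pmulrn_lge0.
Qed.

Let phi (l : R[i]) := Q ('X - l%:P).

Let phi_ge0 l : 0 <= phi l. Proof. exact: Q_ge0. Qed.

Let phi_dist l m : cmod (l - m) <= phi l + phi m.
Proof.
rewrite -QC polyCB -QN (_ : - _ = ('X - l%:P) - ('X - m%:P)); last by ring.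
by rewrite (le_trans (QD _ _))// QN.
Qed.

Let phi_lip l m : phi l <= phi m + cmod (l - m).
Proof.
rewrite -QC -[Q _%:P]QN /phi.
rewrite (_ : 'X - l%:P = ('X - m%:P) + - (l - m)%:P); first exact: QD.
by rewrite polyCB; ring.
Qed.

Let QX p n : Q (p ^+ n) = Q p ^+ n.
Proof. by elim: n => [|n IH]; rewrite ?QC ?cmod1// !exprS QM IH. Qed.

Let Q_prod (r : seq R[i]) :
  Q (\prod_(z <- r) ('X - z%:P)) = \prod_(z <- r) phi z.
Proof.
elim: r => [|z r IH]; first by rewrite !big_nil QC cmod1.
by rewrite !big_cons QM IH.
Qed.

Let m := inf (range phi).

Let m_le l : m <= phi l.
Proof. by apply: ge_inf; [exists 0 => _ [k _ <-]|exists l]. Qed.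

(* [l + s] is a root of [(X - l)^(n+1) - s^(n+1)], and each of the other [n]
   linear factors has seminorm at least [m]. *)
Let phi_shift (m0 : 0 < m) l (s : R) n : 0 <= s ->
  phi (l + s%:C%C) * m ^+ n <= phi l ^+ n.+1 + s ^+ n.+1.
Proof.
move=> s0; pose p : {poly R[i]} := ('X - l%:P) ^+ n.+1 - ((s%:C%C) ^+ n.+1)%:P.
have sz : size (('X - l%:P) ^+ n.+1) = n.+2.
  by rewrite size_exp_XsubC.
have sp : size p = n.+2.
  by rewrite size_polyDl// sz size_polyN (leq_ltn_trans (size_polyC_leq1 _)).
have mp : lead_coef p = 1.
  rewrite lead_coefDl ?sz ?size_polyN ?(leq_ltn_trans (size_polyC_leq1 _))//.
  by apply/monicP; rewrite monic_exp// monicXsubC.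
have [r Er] := closed_field_poly_normal p; rewrite mp scale1r in Er.
have rp : root p (l + s%:C%C).
  by rewrite /root !(hornerE, horner_exp) (addrC l) addrK subrr.
have rin : l + s%:C%C \in r by rewrite Er root_prod_XsubC in rp.
have szr : size r = n.+1.
  by move: sp; rewrite Er size_prod_XsubC => -[].
have Qp : Q p <= phi l ^+ n.+1 + s ^+ n.+1.
  by rewrite (le_trans (QD _ _))// QN QC QX cmodX cmod_real ger0_norm.
apply: le_trans Qp; rewrite Er Q_prod (perm_big _ (perm_to_rem rin)) big_cons/=.
apply: ler_wpM2l => //.
have -> : n = size (rem (l + s%:C%C) r) by rewrite size_rem// szr.
elim: (rem _ _) => [|z r' IH]; first by rewrite big_nil.
by rewrite big_cons /= exprS ler_pM// ?exprn_ge0// ltW.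
Qed.

(** Divided by m^n, [phi_shift] with s = m / 2 contributes s (s / m)^n, which tends to 0. So a point
    where [phi] is nearly minimal remains so after a translation by m / 2, and this can be repeated.
    The exponent n is fixed first; the tolerance d' depends on it. *)
Let phi_stable (m0 : 0 < m) k (e : R) : 0 < e ->
  exists2 d, 0 < d & forall l, phi l <= m + d ->
    phi (l + (k%:R * (m / 2))%:C%C) <= m + e.
Proof.
elim: k e => [|k IH] e e0.
  by exists e => // l; rewrite mul0r addr0.
have [d d0 Hd] := IH _ e0.
suff [d' d'0 Hd'] : exists2 d', 0 < d' &
    forall l, phi l <= m + d' -> phi (l + (m / 2)%:C%C) <= m + d.
  exists d' => // l /Hd'/Hd; congr (phi _ <= _).
  by rewrite -addrA -rmorphD/=; congr (l + _%:C%C); rewrite -(natr1 k); ring.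
have [n Hn] : exists n, m * 2^-1 ^+ n.+1 <= d / 2.
  have := @cvg_expr R 2^-1; rewrite ger0_norm// => /(_ _).
  move=> /(_ ltac:(lra)) /cvgrPdist_le /(_ (d / 2 / m)).
  move=> /(_ ltac:(by rewrite !divr_gt0)) [n _ Hn].
  exists n; have := Hn n.+1 (leqnSn n).
  rewrite sub0r normrN ger0_norm ?exprn_ge0// ler_pdivlMr//.
  by rewrite mulrC.
have mn : 0 < m ^+ n by rewrite exprn_gt0.
have [|d' d'0 Hd'] := @exprD_le _ m n.+1 (d / 2 * m ^+ n) m0.
  by rewrite mulr_gt0// divr_gt0.
exists d' => // l Hl.
have := @phi_shift m0 l (m / 2) n; move=> /(_ ltac:(lra)) H.
rewrite -(ler_pM2r mn) (le_trans H)//.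
have H1 : phi l ^+ n.+1 <= m ^+ n.+1 + d / 2 * m ^+ n.
  by rewrite (le_trans _ Hd')// lerXn2r ?nnegrE//; lra.
have H2 : (m / 2) ^+ n.+1 <= d / 2 * m ^+ n.
  rewrite (_ : _ ^+ _ = m * 2^-1 ^+ n.+1 * m ^+ n) ?ler_pM2r//.
  by rewrite exprMn [m ^+ n.+1]exprS; ring.
by move: H1 H2; rewrite [m ^+ n.+1]exprS; lra.
Qed.

Lemma gelfand_mazur : exists l : R[i], Q ('X - l%:P) = 0.
Proof.
have m_ge0 : 0 <= m.
  apply: lb_le_inf; first by exists (phi 0), 0.
  by move=> _ [k _ <-].
have madh e : 0 < e -> exists l, phi l < m + e.
  move=> e0; have [|_ [l _ <-] H] := @inf_adherent _ (range phi) e e0.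
    by split; [exists (phi 0), 0|exists 0 => _ [t _ <-]].
  by exists l.
have [m0|] := ltP 0 m.
  (* Nine translations move l by 9 m / 2, while [phi] is at most 2 m at both ends, so [phi_dist]
     bounds the distance by 4 m: a contradiction. *)
  have [d d0 Hd] := phi_stable m0 9 m0.
  have [|l Hl] := madh (Num.min d m); first by rewrite lt_min d0.
  have Hd1 : phi l <= m + d.
    by rewrite ltW// (lt_le_trans Hl)// lerD2l ge_min lexx.
  have Hd2 : phi l <= m + m.
    by rewrite ltW// (lt_le_trans Hl)// lerD2l ge_min lexx orbT.
  have := phi_dist (l + (9%:R * (m / 2))%:C%C) l.
  rewrite addrC addKr cmod_real ger0_norm; last by rewrite mulr_ge0//; lra.
  have := Hd _ Hd1; lra.
move=> m_le0; have m0 : m = 0 by apply/eqP; rewrite eq_le m_le0.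
(* The infimum 0 is attained without compactness: for g 1-Lipschitz, [phi_dist] makes any two of the
   intervals of center g l and radius phi l meet, so they all share a point. Taking g = Re and g =
   Im gives the coordinates of the zero. *)
have sep (g : R[i] -> R) : (forall l k, g l - g k <= cmod (l - k)) ->
    exists x, forall l, `|x - g l| <= phi l.
  move=> gL; exists (sup (range (fun l => g l - phi l))) => l.
  have ub k : g k - phi k <= g l + phi l.
    by have := gL k l; have := phi_dist k l; lra.
  rewrite ler_distl; apply/andP; split.
    apply: ub_le_sup; last by exists l.
    by exists (g l + phi l) => _ [k _ <-].
  apply: ge_sup; first by exists (g l - phi l), l.
  by move=> _ [k _ <-].
have [|x Hx] := sep (fun l => complex.Re l).
  case=> a b [c d]; rewrite /= (le_trans (ler_norm _))//.
  rewrite -sqrtr_sqr ler_sqrt /=; last by rewrite addr_ge0 ?sqr_ge0.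
  by rewrite lerDl sqr_ge0.
have [|y Hy] := sep (fun l => complex.Im l).
  case=> a b [c d]; rewrite /= (le_trans (ler_norm _))//.
  rewrite -sqrtr_sqr ler_sqrt /=; last by rewrite addr_ge0 ?sqr_ge0.
  by rewrite lerDr sqr_ge0.
exists (x +i* y)%C; apply/eqP; rewrite eq_le -/(phi _) phi_ge0 andbT.
apply/ler_addgt0Pr => e e0.
have [|l Hl] := madh (e / 3); first by rewrite divr_gt0.
rewrite (le_trans (phi_lip _ l))//.
have : cmod ((x +i* y)%C - l) <= phi l + phi l.
  apply: le_trans (lerD (Hx l) (Hy l)); case: (l) => a b /=.
  rewrite -ler_sqr ?nnegrE ?cmod_ge0 ?addr_ge0//.
  rewrite sqr_sqrtr ?addr_ge0 ?sqr_ge0// [leRHS]sqrrD !real_normK ?num_real//.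
  by rewrite addrAC lerDl mulrn_wge0// mulr_ge0.
lra.
Qed.

End GelfandMazur.

(** * Polynomials in an element of an algebra without unit *)

Section PolynomialAction.
Context {R : realType} {K : lmodType R[i]} (mul : K -> K -> K).
Context (mulA : forall a b c, mul a (mul b c) = mul (mul a b) c).
Context (mulDl : forall a b c, mul (a + b) c = mul a c + mul b c).
Context (mulDr : forall a b c, mul a (b + c) = mul a b + mul a c).
Context (mulZl : forall k a b, mul (k *: a) b = k *: mul a b).
Context (mulZr : forall k a b, mul a (k *: b) = k *: mul a b).
Implicit Types (p q : {poly R[i]}) (x y z : K).

(* [K] need not have a unit, so the action of [p] at [x] is read off on [y]:
   [poly_act x y p] stands for [p(x) y]. *)
Definition poly_act x y p : K := \sum_(i < size p) p`_i *: iter i (mul x) y.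

Let mul0x z : mul 0 z = 0.
Proof. by rewrite -(scale0r (0 : K)) mulZl !scale0r. Qed.

Let mulx0 z : mul z 0 = 0.
Proof. by rewrite -(scale0r (0 : K)) mulZr !scale0r. Qed.

Let mul_sumr I (r : seq I) (F : I -> K) z :
  mul z (\sum_(i <- r) F i) = \sum_(i <- r) mul z (F i).
Proof. by elim/big_rec2: _ => [|i a b _ <-]; rewrite ?mulx0 ?mulDr. Qed.

Lemma poly_actE n x y p : (size p <= n)%N ->
  poly_act x y p = \sum_(i < n) p`_i *: iter i (mul x) y.
Proof.
move=> pn; rewrite /poly_act (big_ord_widen _ (fun i => p`_i *: iter i (mul x) y) pn).
rewrite big_mkcond; apply: eq_bigr => i _.
by case: ltnP => // ip; rewrite nth_default// scale0r.
Qed.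

Lemma poly_actD x y p q : poly_act x y (p + q) = poly_act x y p + poly_act x y q.
Proof.
pose n := maxn (size p) (size q).
rewrite !(@poly_actE n) ?leq_maxl ?leq_maxr ?size_polyD//.
by rewrite -big_split; apply: eq_bigr => i _; rewrite coefD scalerDl.
Qed.

Lemma poly_actZ x y (k : R[i]) p : poly_act x y (k *: p) = k *: poly_act x y p.
Proof.
rewrite !(@poly_actE (size p)) ?size_scale_leq//.
by rewrite scaler_sumr; apply: eq_bigr => i _; rewrite coefZ scalerA.
Qed.

Lemma poly_actC x y (k : R[i]) : poly_act x y k%:P = k *: y.
Proof.
by rewrite (@poly_actE 1) ?size_polyC_leq1// big_ord1 coefC.
Qed.

Lemma poly_actMX x y p : poly_act x y (p * 'X) = mul x (poly_act x y p).
Proof.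
rewrite (@poly_actE (size p).+1) ?size_polyMleq//; last first.
  by rewrite (leq_trans (size_polyMleq _ _))// size_polyX addn2.
rewrite big_ord_recl coefMX eqxx scale0r add0r /poly_act mul_sumr.
by apply: eq_bigr => i _; rewrite coefMX /= mulZr.
Qed.

Lemma poly_actX x y : poly_act x y 'X = mul x y.
Proof. by rewrite -['X]mul1r poly_actMX poly_actC scale1r. Qed.

Lemma poly_actM x y p q : poly_act x y (p * q) = poly_act x (poly_act x y q) p.
Proof.
elim/poly_ind: p => [|p c IH].
  by rewrite mul0r -(scale0r 0) !poly_actZ !scale0r.
by rewrite mulrDl mulrAC !poly_actD !poly_actMX IH poly_actC mul_polyC poly_actZ.
Qed.

Lemma mul_poly_act x y z p : mul (poly_act x y p) z = poly_act x (mul y z) p.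
Proof.
elim/poly_ind: p => [|p c IH].
  by rewrite -(scale0r 0) !poly_actZ !scale0r mul0x.
by rewrite !poly_actD !poly_actMX mulDl -mulA IH !poly_actC mulZl.
Qed.

Lemma mul_poly_act_comm x y z p : mul z x = mul x z ->
  mul z (poly_act x y p) = poly_act x (mul z y) p.
Proof.
move=> zx; elim/poly_ind: p => [|p c IH].
  by rewrite -(scale0r 0) !poly_actZ !scale0r mulx0.
by rewrite !poly_actD !poly_actMX mulDr mulA zx -mulA IH !poly_actC mulZr.
Qed.

(** Here p stands for the element p(x) x. The non-unital algebra generated by x is thus modelled by
    all polynomials under the product X p q. *)
Lemma mul_poly_act_self x p q :
  mul (poly_act x x p) (poly_act x x q) = poly_act x x ('X * p * q).
Proof.
by rewrite mul_poly_act -[mul x (poly_act x x q)]poly_actX -!poly_actM [p * _]mulrC.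
Qed.

End PolynomialAction.

Section Character.
Context {R : realType} {K : lmodType R[i]} (mul : K -> K -> K).
Context (mulA : forall a b c, mul a (mul b c) = mul (mul a b) c).
Context (mulC : forall a b, mul a b = mul b a).
Context (mulDl : forall a b c, mul (a + b) c = mul a c + mul b c).
Context (mulZl : forall k a b, mul (k *: a) b = k *: mul a b).

(** The element [a], with N a nonzero, replaces the unit: p -> N (p(x) a) / N a is a multiplicative
    seminorm on polynomials, and a root X - l of it defines chi x = l. Uniqueness of l makes chi
    linear and multiplicative. *)
Lemma exists_character (nu : K -> R) (a : K) : power_mult_seminorm mul nu ->
  exists chi : K -> R[i],
    [/\ forall k x y, chi (k *: x + y) = k * chi x + chi y,
        forall x y, chi (mul x y) = chi x * chi y,
        forall x, cmod (chi x) <= nu x &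
        cmod (chi a) = nu a].
Proof.
move=> nuP.
have nu_ge0 x : 0 <= nu x by case: nuP => ND NZ _ _; exact: seminorm_ge0.
have mulDr x y z : mul x (y + z) = mul x y + mul x z.
  by rewrite mulC mulDl !(mulC x).
have mulZr k x y : mul x (k *: y) = k *: mul x y by rewrite mulC mulZl mulC.
have [a0|a0] := eqVneq (nu a) 0.
  exists (fun=> 0); split => [*|*|x|]; rewrite ?cmod0 ?mulr0 ?addr0//.
have {}a0 : 0 < nu a by rewrite lt_def a0 nu_ge0.
have [N [[ND NZ _ _] Nnu Na NM]] := multiplicative_seminorm mulA mulC mulDl mulZl nuP a0.
have N_ge0 x : 0 <= N x by exact: seminorm_ge0.
have Na0 : 0 < N a by rewrite Na.
have ex x : exists l, N (mul x a - l *: a) = 0.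
  have [|||l] := @gelfand_mazur R (fun p => N (poly_act mul x a p) / N a).
  (* N (p(x) a) N (q(x) a) = N (p(x) q(x) a) N a, by commutativity and multiplicativity of [N]. *)
  - move=> p q; rewrite mulf_div -NM mul_poly_act//.
    rewrite mul_poly_act_comm// -poly_actM// -mul_poly_act// NM -mulf_div.
    by rewrite divff ?mulr1// gt_eqF.
  - by move=> p q; rewrite -mulrDl ler_pM2r ?invr_gt0// poly_actD.
  - by move=> c; rewrite poly_actC NZ mulfK// gt_eqF.
  rewrite -polyCN poly_actD poly_actX// poly_actC scaleNr => /eqP.
  by rewrite mulf_eq0 invr_eq0 (gt_eqF Na0) orbF => /eqP; exists l.
have [chi chiP] := choice ex.
have uniq x l : N (mul x a - l *: a) = 0 -> l = chi x.
  move=> Nl; apply/eqP; rewrite -subr_eq0; apply/eqP/cmod_eq0.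
  apply/eqP; rewrite -(mulIr_eq0 _ (mulIf (lt0r_neq0 Na0))) -NZ eq_le N_ge0 andbT.
  rewrite scalerBl (_ : _ - _ = (mul x a - chi x *: a) + -1 *: (mul x a - l *: a)).
    by rewrite (le_trans (ND _ _))// NZ Nl chiP mulr0 addr0.
  by rewrite scaleN1r opprB [RHS]addrC addrA subrK.
have chiN x : cmod (chi x) = N x.
  apply: (mulIf (lt0r_neq0 Na0)); rewrite -NZ -NM; apply/eqP; rewrite eq_le.
  apply/andP; split.
    rewrite -{1}(subKr (mul x a) (chi x *: a)) -scaleN1r (le_trans (ND _ _))//.
    by rewrite NZ chiP mulr0 addr0.
  rewrite -{1}(subrK (chi x *: a) (mul x a)) (le_trans (ND _ _))//.
  by rewrite chiP add0r.
exists chi; split.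
- move=> k x y; apply/esym/uniq; apply/eqP; rewrite eq_le N_ge0 andbT.
  rewrite (_ : _ - _ = k *: (mul x a - chi x *: a) + (mul y a - chi y *: a)).
    by rewrite (le_trans (ND _ _))// NZ !chiP mulr0 addr0.
  rewrite mulDl mulZl scalerDl scalerBr scalerA opprD addrACA; congr (_ + _).
- move=> x y; apply/esym/uniq; apply/eqP; rewrite eq_le N_ge0 andbT.
  rewrite (_ : _ - _ = mul x (mul y a - chi y *: a)
                       + chi y *: (mul x a - chi x *: a)).
    by rewrite (le_trans (ND _ _))// NM NZ !chiP !mulr0 addr0.
  rewrite -[- (chi y *: a)]scaleNr mulDr mulZr scaleNr scalerBr addrA subrK.
  by rewrite scalerA mulA (mulrC (chi y)).
- by move=> x; rewrite chiN.
- by rewrite chiN.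
Qed.

End Character.

(** * Polynomial approximation of the absolute value *)

Section AbsoluteValueApproximation.
Context {R : realType}.

(** The classical iteration whose values increase to |t| on [-1, 1]. *)
Fixpoint abs_approx (n : nat) : {poly R[i]} :=
  if n is n'.+1 then
    abs_approx n' + 2^-1 *: ('X ^+ 2 - abs_approx n' ^+ 2)
  else 0.

Fixpoint abs_approx_fun (n : nat) (t : R) : R :=
  if n is n'.+1 then
    abs_approx_fun n' t + 2^-1 * (t ^+ 2 - abs_approx_fun n' t ^+ 2)
  else 0.

Lemma abs_approxE n (t : R) : (abs_approx n).[t%:C%C] = (abs_approx_fun n t)%:C%C.
Proof.
elim: n => [|n IH] /=; first by rewrite horner0.
rewrite !(hornerD, hornerN, hornerZ, hornerXn, horner_exp) IH.
by rewrite !(rmorphD, rmorphN, rmorphM, rmorphXn) /= fmorphV rmorph_nat.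
Qed.

Lemma abs_approx_err n (t : R) : `|t| <= 1 ->
  0 <= abs_approx_fun n t <= `|t| /\
  `|t| - abs_approx_fun n t <= (1 - `|t| / 2) ^+ n.
Proof.
move=> t1; elim: n => [|n [/andP[q0 qt] IH]].
  by rewrite /= lexx normr_ge0 subr0 expr0.
have E : `|t| - abs_approx_fun n.+1 t =
    (`|t| - abs_approx_fun n t) * (1 - (`|t| + abs_approx_fun n t) / 2).
  by rewrite /= -[t ^+ 2]real_normK ?num_real//; field.
have t0 := normr_ge0 t; split.
  have : 0 <= `|t| - abs_approx_fun n.+1 t by rewrite E mulr_ge0//; lra.
  rewrite subr_ge0 => ->; rewrite andbT /= -[t ^+ 2]real_normK ?num_real//.
  by rewrite addr_ge0// mulr_ge0// subr_ge0 lerXn2r.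
rewrite E exprSr ler_pM//; lra.
Qed.

Lemma small_power (x e : R) : 0 <= x -> x < 1 -> 0 < e -> exists n, x ^+ n <= e.
Proof.
move=> x0 x1 e0; have := @cvg_expr R x; rewrite ger0_norm// => /(_ x1).
move=> /cvgrPdist_le /(_ e e0) [n _ Hn]; exists n.
by have := Hn n (leqnn n); rewrite sub0r normrN ger0_norm ?exprn_ge0.
Qed.

(** The geometric rate of [abs_approx_err] degenerates at 0, but there the error is at most |t|
    itself; the two bounds are joined at |t| = d. *)
Lemma abs_approx_cvg (e : R) : 0 < e -> exists n, forall t, `|t| <= 1 ->
  `| `|t| - abs_approx_fun n t| <= e.
Proof.
move=> e0; pose d := Num.min e 1.
have d0 : 0 < d by rewrite lt_min e0 ltr01.
have d1 : d <= 1 by rewrite ge_min lexx orbT.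
have de : d <= e by rewrite ge_min lexx.
have [|||n Hn] := @small_power (1 - d / 2) e; [lra|lra|by []|].
exists n => t t1; have [/andP[q0 qt] H] := abs_approx_err n t1.
rewrite ger0_norm ?subr_ge0//; have [td|td] := leP `|t| d; first lra.
rewrite (le_trans H)// (le_trans _ Hn)// lerXn2r ?nnegrE; lra.
Qed.

(* Continuous functions vanishing at 0 are approximated by polynomials
   without constant term, written [s * P(s)]. *)
Definition approximable (phi : R -> R) : Prop :=
  forall e : R, 0 < e -> exists P : {poly R[i]}, forall s, `|s| <= 1 ->
    cmod ((phi s)%:C%C - s%:C%C * P.[s%:C%C]) <= e.

Lemma approximable_abs_shift (l : R) : `|l| <= 1 ->
  approximable (fun s => `|s - l| - `|l|).
Proof.
move=> l1 e e0; have [|n Hn] := @abs_approx_cvg (e / 4); first by rewrite divr_gt0.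
(* Halving s - l keeps the argument in [-1, 1]. Subtracting the value at 0 makes the polynomial
   divisible by X, and the final factor 2 on two errors of e / 4 gives e. *)
pose W0 := abs_approx n \Po (2^-1 *: ('X - (l%:C%C)%:P)).
have W0E (s : R) : W0.[s%:C%C] = (abs_approx_fun n ((s - l) / 2))%:C%C.
  rewrite horner_comp hornerZ hornerXsubC -rmorphB -abs_approxE; congr (_.[_]).
  by rewrite mulrC rmorphM /= fmorphV rmorph_nat.
have W00 : W0.[0] = (abs_approx_fun n ((0 - l) / 2))%:C%C by rewrite -W0E rmorph0.
have [P HP] : exists P, W0 - (W0.[0])%:P = P * 'X.
  have /factor_theorem[P ->] : root (W0 - (W0.[0])%:P) 0.
    by rewrite /root !hornerE subrr.
  by exists P; rewrite subr0.
exists (2%:R *: P) => s s1.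
have -> : s%:C%C * (2%:R *: P).[s%:C%C] =
    (2 * (abs_approx_fun n ((s - l) / 2) - abs_approx_fun n ((0 - l) / 2)))%:C%C.
  rewrite hornerZ mulrCA [s%:C%C * _]mulrC -hornerMX -HP hornerD hornerN hornerC.
  by rewrite W00 W0E rmorphM rmorphB /= rmorph_nat.
rewrite -rmorphB cmod_real.
have H1 := Hn ((s - l) / 2); have H2 := Hn ((0 - l) / 2).
have n2 (x : R) : `|x / 2| = `|x| / 2 by rewrite normrM normfV (@ger0_norm _ 2).
rewrite !n2 sub0r normrN in H1 H2.
have sl := ler_normB s l.
have h1 : `|s - l| / 2 <= 1 by lra.
have h2 : `|l| / 2 <= 1 by lra.
move: (H1 h1) (H2 h2); rewrite sub0r !ler_norml; lra.
Qed.

Lemma approximable_lin (k : R) (phi psi : R -> R) :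
  approximable phi -> approximable psi -> approximable (fun s => k * phi s + psi s).
Proof.
move=> Hphi Hpsi e e0; pose d := e / (2 * (`|k| + 1)).
have k0 : 0 < 2 * (`|k| + 1) by rewrite mulr_gt0// ltr_wpDl.
have d0 : 0 < d by rewrite divr_gt0.
have dE : d * (2 * (`|k| + 1)) = e by rewrite divfK// gt_eqF.
have [P HP] := Hphi d d0; have [Q HQ] := Hpsi d d0.
exists (k%:C%C *: P + Q) => s s1; rewrite hornerD hornerZ.
have -> : (k * phi s + psi s)%:C%C - s%:C%C * (k%:C%C * P.[s%:C%C] + Q.[s%:C%C]) =
    k%:C%C * ((phi s)%:C%C - s%:C%C * P.[s%:C%C]) + ((psi s)%:C%C - s%:C%C * Q.[s%:C%C]).
  by rewrite rmorphD rmorphM /=; ring.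
rewrite (le_trans (cmodD _ _))// cmodM cmod_real.
have := ler_wpM2l (normr_ge0 k) (HP s s1); have := HQ s s1; lra.
Qed.

End AbsoluteValueApproximation.

Section Ramp.
Context {R : realType}.
Implicit Types u l m s : R.

(* For [u] a sign, the ramp [min (max (u * s - l, 0), m - l)]. *)
Definition ramp u l m s : R := (`|s - u * l| - `|s - u * m| + (m - l)) / 2.

Lemma ramp_approximable u l m : `|u| = 1 -> 0 <= l <= 1 -> 0 <= m <= 1 ->
  approximable (ramp u l m).
Proof.
move=> u1 /andP[l0 l1] /andP[m0 m1].
have ul : `|u * l| = l by rewrite normrM u1 mul1r ger0_norm.
have um : `|u * m| = m by rewrite normrM u1 mul1r ger0_norm.
have al : approximable (fun s => `|s - u * l| - `|u * l|).
  by apply: approximable_abs_shift; rewrite ul.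
have am : approximable (fun s => `|s - u * m| - `|u * m|).
  by apply: approximable_abs_shift; rewrite um.
have a0 : approximable (fun=> 0 : R).
  by move=> e e0; exists 0 => s _; rewrite horner0 mulr0 subrr cmod0 ltW.
have := approximable_lin 2^-1 al (approximable_lin (- 2^-1) am a0).
by congr approximable; apply/funext => s; rewrite /ramp ul um; field.
Qed.

Lemma ramp_ge0 u l m s : `|u| = 1 -> l <= m -> 0 <= ramp u l m s <= m - l.
Proof.
move=> u1 lm; have : `| `|s - u * l| - `|s - u * m| | <= m - l.
  rewrite (le_trans (ler_dist_dist _ _))//.
  rewrite (_ : _ - _ = u * (m - l)); last by ring.
  by rewrite normrM u1 mul1r ger0_norm// subr_ge0.
by rewrite /ramp ler_norml; lra.
Qed.

(** The upper ramp vanishes for u s <= m, and beyond m the lower one is saturated at m - l. *)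
Lemma ramp_disjoint u l m l' m' s : `|u| = 1 -> l <= m -> m <= l' -> l' <= m' ->
  ramp u l' m' s * ramp u l m s = (m - l) * ramp u l' m' s.
Proof.
move=> u1 lm ml lm'.
have uu : u * u = 1 by rewrite -expr2 -real_normK ?num_real// u1 expr1n.
have E x : `|s - u * x| = `|u * s - x|.
  by rewrite -[LHS]mul1r -u1 -normrM mulrBr mulrA uu mul1r.
rewrite /ramp !E; set t := u * s; have [tm|mt] := leP t m.
  rewrite (_ : `|t - l'| - `|t - m'| + (m' - l') = 0) ?mul0r ?mulr0//.
  by rewrite !ler0_norm; lra.
rewrite (_ : `|t - l| - `|t - m| + (m - l) = 2 * (m - l)).
  by field.
by rewrite !ger0_norm; lra.
Qed.

Lemma ramp_telescope u l n s : (0 < n)%N ->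
  \sum_(i < n) ramp u (i%:R * l) (i.+1%:R * l) s = ramp u 0 (n%:R * l) s.
Proof.
elim: n => // -[_ _|n IH _]; first by rewrite big_ord1 mul0r.
by rewrite big_ord_recr /= IH// /ramp; lra.
Qed.

Lemma ramp_pos_neg s : `|s| <= 1 -> ramp 1 0 1 s - ramp (-1) 0 1 s = s.
Proof.
rewrite ler_norml => /andP[s1 s2]; rewrite /ramp !mulr0 subr0 mulr1 mulN1r.
rewrite (@ler0_norm _ (s - 1)); last lra.
by rewrite (@ger0_norm _ (s - - 1)); lra.
Qed.

End Ramp.

(** * C*-algebras without nilpotents *)

Section CStarAlgebra.
Context {R : realType} {A : lmodType R[i]} (mul : A -> A -> A) (star : A -> A)
  (nrm : A -> R).
Context (HA : is_cstar_algebra mul star nrm).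

Let mulA a b c : mul a (mul b c) = mul (mul a b) c.
Proof. by case: HA => -[]. Qed.
Let mulDl a b c : mul (a + b) c = mul a c + mul b c.
Proof. by case: HA => -[_ /(_ a b c)[]]. Qed.
Let mulDr a b c : mul a (b + c) = mul a b + mul a c.
Proof. by case: HA => -[_ /(_ a b c)[]]. Qed.
Let mulZl k a b : mul (k *: a) b = k *: mul a b.
Proof. by case: HA => -[_ _ /(_ k a b)[]]. Qed.
Let mulZr k a b : mul a (k *: b) = k *: mul a b.
Proof. by case: HA => -[_ _ /(_ k a b)[]]. Qed.
Let nrm_eq0 a : nrm a = 0 -> a = 0.
Proof. by case: HA => _ [[/(_ a)]]. Qed.
Let nrmZ k a : nrm (k *: a) = cmod k * nrm a.
Proof. by case: HA => _ [[_ ->]]. Qed.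
Let nrmD a b : nrm (a + b) <= nrm a + nrm b.
Proof. by case: HA => _ [[_ _ ->]]. Qed.
Let nrmM a b : nrm (mul a b) <= nrm a * nrm b.
Proof. by case: HA => _ [_ [_ [->]]]. Qed.
Let starD a b : star (a + b) = star a + star b.
Proof. by case: HA => _ [_ [_ [_ [[->]]]]]. Qed.
Let starZ k a : star (k *: a) = (k^*)%C *: star a.
Proof. by case: HA => _ [_ [_ [_ [[_ ->]]]]]. Qed.
Let starK a : star (star a) = a.
Proof. by case: HA => _ [_ [_ [_ [[_ _ ->]]]]]. Qed.
Let starM a b : star (mul a b) = mul (star b) (star a).
Proof. by case: HA => _ [_ [_ [_ [[_ _ _ ->]]]]]. Qed.
Let nrm_star_mul a : nrm (mul (star a) a) = nrm a ^+ 2.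
Proof. by case: HA => _ [_ [_ [_ [_ ->]]]]. Qed.

Lemma cstar_nrm_ge0 a : 0 <= nrm a.
Proof.
by case: HA => _ [[_ NZ ND] _]; exact: seminorm_ge0.
Qed.

Let nrm_ge0 := cstar_nrm_ge0.

Lemma cstar_nrm_star a : nrm (star a) = nrm a.
Proof.
suff le b : nrm b <= nrm (star b).
  by apply/eqP; rewrite eq_le le andbT; have := le (star a); rewrite starK.
have [->|b0] := eqVneq (nrm b) 0; first exact: nrm_ge0.
have {}b0 : 0 < nrm b by rewrite lt_def b0 nrm_ge0.
by rewrite -(ler_pM2r b0) -expr2 -nrm_star_mul nrmM.
Qed.

Lemma cstar_normal_sqr a : mul (star a) a = mul a (star a) ->
  nrm (mul a a) = nrm a ^+ 2.
Proof.
move=> aN; apply/eqP; rewrite -(@eqrXn2 _ 2%N) ?exprn_ge0 ?nrm_ge0//; apply/eqP.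
suff -> : nrm (mul a a) ^+ 2 = nrm (mul (star a) a) ^+ 2 by rewrite nrm_star_mul.
rewrite -!nrm_star_mul !starM starK; congr nrm.
by rewrite -!mulA; congr mul; rewrite !mulA aN.
Qed.

Let nrmN a : nrm (- a) = nrm a.
Proof. by rewrite -scaleN1r nrmZ cmodN cmod1 mul1r. Qed.
Let mulx0 a : mul a 0 = 0.
Proof. by rewrite -(scale0r (0 : A)) mulZr !scale0r. Qed.
Let mul0x a : mul 0 a = 0.
Proof. by rewrite -(scale0r (0 : A)) mulZl !scale0r. Qed.
Let star0 : star 0 = 0.
Proof. by rewrite -(scale0r (0 : A)) starZ conjc0 !scale0r. Qed.
Let nrm0 : nrm 0 = 0.
Proof. by rewrite -(scale0r (0 : A)) nrmZ cmod0 mul0r. Qed.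

Local Notation ev a := (poly_act mul a a).

Let poly_actB b P Q : ev b (P - Q) = ev b P - ev b Q.
Proof. by rewrite -[- Q]scaleN1r poly_actD poly_actZ scaleN1r. Qed.

Lemma star_poly_act a (P : {poly R[i]}) : star a = a ->
  star (ev a P) = ev a (map_poly conjc P).
Proof.
move=> sa; elim/poly_ind: P => [|P c IH].
  by rewrite rmorph0 -(scale0r (0 : {poly _})) !poly_actZ starZ conjc0 !scale0r.
rewrite rmorphD rmorphM /= map_polyX map_polyC !poly_actD !poly_actMX//.
rewrite !poly_actC starD starM sa IH starZ sa; congr (_ + _).
by rewrite mul_poly_act// mul_poly_act_comm.
Qed.

Lemma poly_act_normal a (P : {poly R[i]}) : star a = a ->
  nrm (mul (ev a P) (ev a P)) = nrm (ev a P) ^+ 2.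
Proof.
move=> sa; apply: cstar_normal_sqr; rewrite star_poly_act//.
by rewrite !mul_poly_act_self// mulrAC.
Qed.

(* Adding [i t] to a self-adjoint element of norm at most 1 keeps its norm
   below [sqrt (1 + t^2)]; a character value off the real line would violate
   this bound for large [t]. *)
Lemma nrm_sa_shift a y (t : R) : star a = a -> nrm a <= 1 ->
  nrm (mul a y + ('i * t%:C)%C *: y) ^+ 2 <= (1 + t ^+ 2) * nrm y ^+ 2.
Proof.
move=> sa a1; rewrite -nrm_star_mul starD starM sa starZ.
have -> : (('i * t%:C)^*)%C = - ('i * t%:C)%C :> R[i] by simpc.
set k := ('i * t%:C)%C.
rewrite (_ : mul _ _ = mul (mul (star y) a) (mul a y) +
    (t ^+ 2)%:C%C *: mul (star y) y); last first.
  rewrite mulDl !mulDr !mulZl !mulZr (mulA (star y) a y) !scaleNr addrA addrK.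
  rewrite scalerA -scaleNr; congr (_ + _ *: _).
  by rewrite /k mulrACA -expr2 sqr_i mulN1r opprK -rmorphM expr2.
rewrite (le_trans (nrmD _ _))// nrmZ nrm_star_mul cmod_real ger0_norm ?sqr_ge0//.
rewrite mulrDl lerD2r mul1r (le_trans (nrmM _ _))// expr2.
have H1 : nrm (mul (star y) a) <= nrm y.
  rewrite (le_trans (nrmM _ _))// cstar_nrm_star.
  by rewrite -[leRHS]mulr1 ler_wpM2l.
have H2 : nrm (mul a y) <= nrm y.
  by rewrite (le_trans (nrmM _ _))// -[leRHS]mul1r ler_wpM2r.
exact: ler_pM.
Qed.

(** The polynomials with the product X p q carry the power multiplicative seminorm [nrm (ev a p)]; a
    character attains it at [P]. The polynomial 1 stands for [a], so l = chi 1 is the spectral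
    value, chi p = l p(l), and [nrm_sa_shift] confines l to [-1, 1]. *)
Lemma sa_spectral_point a (P : {poly R[i]}) : star a = a -> nrm a <= 1 ->
  exists2 s : R, `|s| <= 1 & nrm (ev a P) = cmod (s%:C%C * P.[s%:C%C]).
Proof.
move=> sa a1.
pose mulK (p q : {poly R[i]}) := 'X * p * q.
have pm : power_mult_seminorm mulK (fun p => nrm (ev a p)).
  split.
  - by move=> p q; rewrite poly_actD.
  - by move=> k p; rewrite poly_actZ nrmZ.
  - by move=> p q; rewrite /mulK -mul_poly_act_self.
  - by move=> p; rewrite /mulK -mul_poly_act_self// poly_act_normal.
have KA p q r : mulK p (mulK q r) = mulK (mulK p q) r by rewrite /mulK; ring.
have KC p q : mulK p q = mulK q p by rewrite /mulK; ring.
have KD p q r : mulK (p + q) r = mulK p r + mulK q r by rewrite /mulK; ring.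
have KZ k p q : mulK (k *: p) q = k *: mulK p q.
  by rewrite /mulK -scalerAr -scalerAl.
have [chi [chiL chiM chile chiP]] := exists_character KA KC KD KZ P pm.
have chi0 : chi 0 = 0.
  by have := chiL (-1) 0 0; rewrite scaler0 addr0 mulN1r addNr.
have chiD p q : chi (p + q) = chi p + chi q.
  by have := chiL 1 p q; rewrite scale1r mul1r.
have chiZ k p : chi (k *: p) = k * chi p.
  by have := chiL k p 0; rewrite !addr0 chi0 addr0.
pose l := chi 1.
have chiX p : chi (p * 'X) = l * chi p.
  by rewrite -chiM /mulK mulr1 mulrC.
have chiE p : chi p = l * p.[l].
  elim/poly_ind: p => [|p c IH]; first by rewrite chi0 horner0 mulr0.
  rewrite chiD chiX IH -[c%:P]mulr1 mul_polyC chiZ -/l hornerD hornerMX hornerZ -[1]/(1%:P) hornerC.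
  by ring.
have [y0|y0] := eqVneq (nrm (ev a P)) 0.
  by exists 0; [rewrite normr0|rewrite y0 mul0r cmod0].
have {}y0 : 0 < nrm (ev a P) by rewrite lt_def y0 nrm_ge0.
have lt (t : R) : complex.Re l ^+ 2 + (complex.Im l + t) ^+ 2 <= 1 + t ^+ 2.
  have -> : complex.Re l ^+ 2 + (complex.Im l + t) ^+ 2 =
      cmod (l + ('i * t%:C)%C) ^+ 2.
    by rewrite cmod_sqr; case: (l) => u v /=; rewrite !mul0r !mul1r subr0 !addr0 add0r.
  rewrite -(@ler_pM2r _ (nrm (ev a P) ^+ 2)) ?exprn_gt0// -{1}chiP -exprMn -cmodM.
  apply: le_trans (nrm_sa_shift (ev a P) t sa a1).
  rewrite lerXn2r ?nnegrE ?cmod_ge0//.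
  have -> : (l + ('i * t%:C)%C) * chi P = chi (P * 'X + ('i * t%:C)%C *: P).
    by rewrite chiD chiX chiZ mulrDl.
  by rewrite (le_trans (chile _))// poly_actD poly_actMX// poly_actZ.
have Im0 : complex.Im l = 0.
  (* At t = 1 / Im l the cross term of the square is 2, which exceeds the 1 allowed on the right. *)
  apply/eqP/negP => /negP Im0; have := lt (complex.Im l)^-1.
  rewrite sqrrD mulfV//.
  have := sqr_ge0 (complex.Re l); have := sqr_ge0 (complex.Im l); lra.
have lE : l = (complex.Re l)%:C%C by move: Im0; case: (l) => u v /= ->.
exists (complex.Re l).
  rewrite -(@ler_sqr _ `|_|) ?nnegrE// real_normK ?num_real//.
  by have := lt 0; rewrite Im0 addr0 expr0n /=; lra.
by rewrite -lE -chiE.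
Qed.

Lemma sa_nrm_le b (P : {poly R[i]}) M : star b = b -> nrm b <= 1 ->
  (forall s : R, `|s| <= 1 -> cmod (s%:C%C * P.[s%:C%C]) <= M) ->
  nrm (ev b P) <= M.
Proof.
by move=> sb b1 H; have [s s1 ->] := sa_spectral_point P sb b1; exact: H.
Qed.

(** For b = a / |a| take u = 1 - (1 - b^2)^n. The error s (1 - s^2)^n is at most d when |s| <= d,
    and at most (1 - d^2)^n otherwise. Since u is a polynomial multiple of b, it kills whatever a
    kills from the left. *)
Lemma approx_unit a (e : R) : star a = a -> 0 < e -> exists u,
  [/\ star u = u, nrm u <= 1, nrm (mul u a - a) <= e &
      forall b, mul a b = 0 -> mul u b = 0].
Proof.
move=> sa e0; have [a0|a0] := eqVneq (nrm a) 0.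
  exists 0; rewrite star0 nrm0 (nrm_eq0 a0) mulx0 subr0 nrm0.
  by split => //; rewrite ?(ltW e0)// => b; rewrite mul0x.
have {}a0 : 0 < nrm a by rewrite lt_def a0 nrm_ge0.
pose k := (nrm a)%:C%C; pose b := k^-1 *: a.
have k0 : k != 0 by rewrite fmorph_eq0 gt_eqF.
have ab : a = k *: b by rewrite scalerA mulfV// scale1r.
have sb : star b = b by rewrite starZ sa conjc_inv conjc_real.
have b1 : nrm b <= 1.
  by rewrite nrmZ cmodV cmod_real ger0_norm// mulVf// gt_eqF.
pose d := Num.min (e / nrm a) (2^-1).
have d0 : 0 < d by rewrite lt_min divr_gt0//= invr_gt0.
have dh : d <= 2^-1 by rewrite ge_min lexx orbT.
have de : d * nrm a <= e by rewrite -ler_pdivlMr// ge_min lexx.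
have d20 : 0 < d ^+ 2 by rewrite exprn_gt0.
have d21 : d ^+ 2 <= 1 by rewrite exprn_ile1//; lra.
have x0 : 0 <= 1 - d ^+ 2 by lra.
have x1 : 1 - d ^+ 2 < 1 by lra.
have [n Hn] := small_power x0 x1 d0.
pose P : {poly R[i]} := 'X * \sum_(i < n) (1 - 'X ^+ 2) ^+ i.
have PE (s : R) : s%:C%C * P.[s%:C%C] = (1 - (1 - s ^+ 2) ^+ n)%:C%C.
  rewrite mulrC -hornerMX /P mulrAC -expr2.
  have -> : 'X ^+ 2 * \sum_(i < n) (1 - 'X ^+ 2) ^+ i =
      1 - (1 - 'X ^+ 2) ^+ n :> {poly R[i]}.
    by rewrite -[RHS]opprB subrX1 -[RHS]mulNr opprB subKr.
  rewrite hornerD hornerN horner_exp hornerD hornerN hornerXn -[1%R]/(1%:P) !hornerC.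
  by rewrite rmorphB rmorphXn rmorphB rmorphXn rmorph1.
have pows (s : R) : `|s| <= 1 -> 0 <= (1 - s ^+ 2) ^+ n <= 1.
  move=> s1; have s2 : s ^+ 2 <= 1 by rewrite -real_normK ?num_real// exprn_ile1.
  have := sqr_ge0 s => s0.
  by rewrite exprn_ge0 ?exprn_ile1//; lra.
exists (ev b P); split.
- rewrite star_poly_act//; congr poly_act; rewrite rmorphM /= map_polyX; congr (_ * _).
  rewrite rmorph_sum; apply: eq_bigr => i _.
  by rewrite rmorphXn rmorphB rmorphXn rmorph1 /= map_polyX.
- apply: sa_nrm_le => // s s1; rewrite PE cmod_real.
  by have /andP[? ?] := pows s s1; rewrite ger0_norm; lra.
- rewrite ab mulZr -scalerBr nrmZ /k cmod_real gtr0_norm// mulrC.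
  apply: le_trans de; rewrite ler_pM2r//.
  have -> : mul (ev b P) b - b = ev b (P * 'X - 1).
    by rewrite poly_actB -[ev b 1]/(ev b 1%:P) poly_actC scale1r mul_poly_act//
      poly_actM// poly_actX.
  apply: sa_nrm_le => // s s1.
  rewrite hornerD hornerN hornerMX hornerC [P.[_] * _]mulrC PE mulrC.
  rewrite -(rmorph1 (@real_complex R)) -rmorphB -rmorphM cmod_real.
  have /andP[q0 q1] := pows s s1.
  rewrite (_ : _ * s = - (s * (1 - s ^+ 2) ^+ n)); last by ring.
  rewrite normrN normrM (ger0_norm q0).
  have [sd|sd] := leP `|s| d; first by have := normr_ge0 s; nra.
  have s2 : s ^+ 2 <= 1 by rewrite -real_normK ?num_real// exprn_ile1.
  have ds : d ^+ 2 <= s ^+ 2.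
    by rewrite -[s ^+ 2]real_normK ?num_real// lerXn2r ?nnegrE// ltW.
  have qd : (1 - s ^+ 2) ^+ n <= (1 - d ^+ 2) ^+ n.
    by apply: lerXn2r; rewrite ?nnegrE//; lra.
  by rewrite -[leRHS]mul1r ler_pM// (le_trans qd).
- move=> c ac; rewrite mul_poly_act//.
  have <- : mul b 0 = mul b c by rewrite mulx0 mulZl ac scaler0.
  by rewrite -mul_poly_act// mulx0.
Qed.

(** The C*-identity removes z and leaves e1^2 + e2^2. Repeated squaring keeps the two summands
    orthogonal contractions, so every 2^k-th power of the norm is at most 2, which forces the norm
    to be at most 1. *)
Lemma orthogonal_contraction e1 e2 (z : R[i]) : star e1 = e1 -> star e2 = e2 ->
  mul e1 e2 = 0 -> nrm e1 <= 1 -> nrm e2 <= 1 -> cmod z = 1 ->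
  nrm (e1 + z *: e2) <= 1.
Proof.
move=> s1 s2 e12 n1 n2 z1.
have e21 : mul e2 e1 = 0 by rewrite -s1 -s2 -starM e12.
have sqE : nrm (e1 + z *: e2) ^+ 2 = nrm (mul e1 e1 + mul e2 e2).
  rewrite -nrm_star_mul starD starZ s1 s2 mulDl !mulDr !mulZl !mulZr e12 e21.
  rewrite !scaler0 addr0 add0r scalerA mulrC.
  have -> : (z * z^*)%C = (cmod z ^+ 2)%:C%C.
    rewrite cmod_sqr; case: (z) => u v; apply/eqP; rewrite eq_complex /=.
    by apply/andP; split; apply/eqP; ring.
  by rewrite z1 expr1n scale1r.
have pw k : forall f1 f2, star f1 = f1 -> star f2 = f2 -> mul f1 f2 = 0 ->
    nrm f1 <= 1 -> nrm f2 <= 1 -> nrm (f1 + f2) ^+ (2 ^ k) <= 2.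
  elim: k => [|k IH] f1 f2 t1 t2 f12 m1 m2.
    by rewrite expn0 expr1; apply: (le_trans (nrmD _ _)); lra.
  have f21 : mul f2 f1 = 0 by rewrite -t1 -t2 -starM f12.
  rewrite expnS exprM -nrm_star_mul starD t1 t2 mulDl !mulDr f12 f21 addr0 add0r.
  apply: IH; rewrite ?starM ?t1 ?t2//.
  - by rewrite -mulA (mulA f1 f2) f12 mul0x mulx0.
  - by rewrite (le_trans (nrmM _ _))// mulr_ile1.
  - by rewrite (le_trans (nrmM _ _))// mulr_ile1.
rewrite -(@expr_le1 _ 2)// sqE; rewrite leNgt; apply/negP => gt1.
set x := nrm _ in gt1.
have x0 : 0 < x by lra.
have xV0 : 0 <= x^-1 by rewrite invr_ge0 ltW.
have xV1 : x^-1 < 1 by rewrite invf_lt1.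
have [n Hn] := small_power xV0 xV1 (ltac:(by rewrite invr_gt0) : 0 < 3^-1).
have : x ^+ (2 ^ n) <= 2.
  by apply: pw; rewrite ?starM ?s1 ?s2//; [rewrite -mulA (mulA e1 e2) e12 mul0x mulx0
   |rewrite (le_trans (nrmM _ _))// mulr_ile1|rewrite (le_trans (nrmM _ _))// mulr_ile1].
have : x ^+ n <= x ^+ (2 ^ n).
  by rewrite ler_eXn2l// ltnW// ltn_expl.
have : 3 <= x ^+ n by rewrite -lef_pV2 ?posrE ?exprn_gt0// -exprVn.
lra.
Qed.

Let complete (u : nat -> A) :
  (forall e : R, 0 < e -> exists N, forall m n,
     (N <= m)%N -> (N <= n)%N -> nrm (u m - u n) < e) ->
  exists l, forall e : R, 0 < e -> exists N, forall n,
     (N <= n)%N -> nrm (u n - l) < e.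
Proof. by case: HA => _ [_ [+ _]]; exact. Qed.

(** * Functional calculus of a self-adjoint contraction *)

Section Calculus.
Context (b : A) (sb : star b = b) (b1 : nrm b <= 1).

(** The graph of phi -> phi(b). One and the same P must approximate phi on [-1, 1] and c in norm;
    this is what ties c to phi. *)
Definition fcalc (phi : R -> R) (c : A) : Prop :=
  forall e : R, 0 < e -> exists P : {poly R[i]},
    (forall s, `|s| <= 1 -> cmod ((phi s)%:C%C - s%:C%C * P.[s%:C%C]) <= e) /\
    nrm (c - ev b P) <= e.

Lemma fcalc_nrm_le phi c M : fcalc phi c ->
  (forall s, `|s| <= 1 -> `|phi s| <= M) -> nrm c <= M.
Proof.
move=> Hc HM; apply/ler_addgt0Pr => e e0.
have [|P [HP HcP]] := Hc (e / 2); first by rewrite divr_gt0.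
have HP' : nrm (ev b P) <= M + e / 2.
  apply: sa_nrm_le => // s s1.
  rewrite -(subKr (phi s)%:C%C (_ * _)) (le_trans (cmodB _ _))// cmod_real.
  by rewrite lerD ?HM ?HP.
rewrite -(subrK (ev b P) c) (le_trans (nrmD _ _))//; lra.
Qed.

Lemma fcalc_lin (k : R) phi psi c d : fcalc phi c -> fcalc psi d ->
  fcalc (fun s => k * phi s + psi s) (k%:C%C *: c + d).
Proof.
move=> Hphi Hpsi e e0; pose f := e / (2 * (`|k| + 1)).
have k0 : 0 < 2 * (`|k| + 1) by rewrite mulr_gt0// ltr_wpDl.
have f0 : 0 < f by rewrite divr_gt0.
have fE : f * (2 * (`|k| + 1)) = e by rewrite divfK// gt_eqF.
have [P [HP HcP]] := Hphi f f0; have [Q [HQ HdQ]] := Hpsi f f0.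
exists (k%:C%C *: P + Q); split.
  move=> s s1; rewrite hornerD hornerZ.
  have -> : (k * phi s + psi s)%:C%C - s%:C%C * (k%:C%C * P.[s%:C%C] + Q.[s%:C%C]) =
      k%:C%C * ((phi s)%:C%C - s%:C%C * P.[s%:C%C]) + ((psi s)%:C%C - s%:C%C * Q.[s%:C%C]).
    by rewrite rmorphD rmorphM /=; ring.
  rewrite (le_trans (cmodD _ _))// cmodM cmod_real.
  have := ler_wpM2l (normr_ge0 k) (HP s s1); have := HQ s s1; lra.
rewrite poly_actD poly_actZ opprD addrACA -scalerBr (le_trans (nrmD _ _))//.
rewrite nrmZ cmod_real.
have := ler_wpM2l (normr_ge0 k) HcP; have := normr_ge0 k; nra.
Qed.

Lemma fcalc_ext phi psi c : (forall s, `|s| <= 1 -> phi s = psi s) ->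
  fcalc phi c -> fcalc psi c.
Proof.
move=> E Hc e e0; have [P [HP HcP]] := Hc e e0.
by exists P; split => // s s1; rewrite -E// HP.
Qed.

Lemma fcalc_uniq phi c d : fcalc phi c -> fcalc phi d -> c = d.
Proof.
move=> Hc Hd; apply/eqP; rewrite -subr_eq0; apply/eqP/nrm_eq0.
apply/eqP; rewrite eq_le nrm_ge0 andbT -nrmN opprB.
have := @fcalc_nrm_le _ _ 0 (fcalc_lin (-1) Hc Hd).
by rewrite rmorphN1 scaleN1r addrC; apply => s _; rewrite mulN1r addNr normr0.
Qed.

Lemma fcalc0 : fcalc (fun=> 0) 0.
Proof.
move=> e e0; exists 0; split.
  by move=> s s1; rewrite horner0 mulr0 subrr cmod0 ltW.
by rewrite -(scale0r (0 : {poly _})) poly_actZ scale0r subrr nrm0 ltW.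
Qed.

Lemma fcalc_id : fcalc id b.
Proof.
move=> e e0; exists 1%:P; split.
  by move=> s s1; rewrite hornerC mulr1 subrr cmod0 ltW.
by rewrite poly_actC scale1r subrr nrm0 ltW.
Qed.

Lemma fcalc_mul phi psi c d :
  (forall s, `|s| <= 1 -> `|phi s| <= 1) -> (forall s, `|s| <= 1 -> `|psi s| <= 1) ->
  fcalc phi c -> fcalc psi d -> fcalc (fun s => phi s * psi s) (mul c d).
Proof.
(* One factor is bounded by 1; the other, an approximant, by 2 because f <= 1. The total error is f
   + 2 f. *)
move=> phi1 psi1 Hc Hd e e0; pose f := Num.min 1 (e / 3).
have f0 : 0 < f by rewrite lt_min ltr01 divr_gt0.
have f1 : f <= 1 by rewrite ge_min lexx.
have fe : 3 * f <= e by rewrite mulrC -ler_pdivlMr// ge_min lexx orbT.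
have [P [HP HcP]] := Hc f f0; have [Q [HQ HdQ]] := Hd f f0.
exists ('X * P * Q); split.
  move=> s s1; rewrite !hornerM hornerX.
  have -> : (phi s * psi s)%:C%C - s%:C%C * (s%:C%C * P.[s%:C%C] * Q.[s%:C%C]) =
      (phi s)%:C%C * ((psi s)%:C%C - s%:C%C * Q.[s%:C%C]) +
      ((phi s)%:C%C - s%:C%C * P.[s%:C%C]) *
      ((psi s)%:C%C - ((psi s)%:C%C - s%:C%C * Q.[s%:C%C])).
    by rewrite rmorphM /=; ring.
  rewrite (le_trans (cmodD _ _))// !cmodM cmod_real.
  have h1 := phi1 s s1; have h2 := HP s s1; have h3 := HQ s s1.
  have h4 : cmod ((psi s)%:C%C - ((psi s)%:C%C - s%:C%C * Q.[s%:C%C])) <= 2.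
    rewrite (le_trans (cmodB _ _))// cmod_real; have := psi1 s s1; lra.
  have h5 := ler_pM (normr_ge0 _) (cmod_ge0 _) h1 h3.
  have h6 := ler_pM (cmod_ge0 _) (cmod_ge0 _) h2 h4.
  lra.
rewrite -mul_poly_act_self//.
have -> : mul c d - mul (ev b P) (ev b Q) =
    mul c (d - ev b Q) + mul (c - ev b P) (ev b Q).
  by rewrite -scaleN1r -[- ev b P]scaleN1r -[- ev b Q]scaleN1r mulDl mulDr
    mulZl mulZr !scaleN1r addrA subrK.
have c1 := fcalc_nrm_le Hc phi1.
have Q2 : nrm (ev b Q) <= 2.
  have d1 := fcalc_nrm_le Hd psi1.
  rewrite -(subKr d (ev b Q)) (le_trans (nrmD _ _))// nrmN; lra.
rewrite (le_trans (nrmD _ _))//.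
have h1 := le_trans (nrmM _ _) (ler_pM (nrm_ge0 _) (nrm_ge0 _) c1 HdQ).
have h2 := le_trans (nrmM _ _) (ler_pM (nrm_ge0 _) (nrm_ge0 _) HcP Q2).
lra.
Qed.

(** As phi is real, conjugating the coefficients of the approximants shows that [star c] also
    represents phi; uniqueness concludes. *)
Lemma fcalc_star phi c : fcalc phi c -> star c = c.
Proof.
move=> Hc; apply: (fcalc_uniq _ Hc) => e e0.
have [P [HP HcP]] := Hc e e0; exists (map_poly conjc P); split.
  move=> s s1.
  have -> : s%:C%C * (map_poly conjc P).[s%:C%C] = ((s%:C%C * P.[s%:C%C])^*)%C.
    rewrite rmorphM -horner_map; congr (_ * _.[_]); exact/esym/conjc_real.
  by rewrite -[(phi s)%:C%C]conjc_real -(rmorphB (@conjc R)) cmod_conj HP.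
rewrite -star_poly_act// -[- star _]scaleN1r.
have -> : -1 *: star (ev b P) = star (-1 *: ev b P) by rewrite starZ rmorphN1.
by rewrite -starD scaleN1r cstar_nrm_star.
Qed.

(** Approximants with uniform error 1 / (n + 1) give a Cauchy sequence by [sa_nrm_le]; completeness
    of the algebra enters here. *)
Lemma fcalc_exists phi : approximable phi -> exists c, fcalc phi c.
Proof.
move=> aphi.
have Pex n : exists P : {poly R[i]}, forall s, `|s| <= 1 ->
    cmod ((phi s)%:C%C - s%:C%C * P.[s%:C%C]) <= n.+1%:R^-1.
  by apply: aphi; rewrite invr_gt0.
have [P HP] := choice Pex.
have inv_small (e : R) : 0 < e -> exists N, forall n, (N <= n)%N -> n.+1%:R^-1 < e.
  move=> e0; have /cvgrPdist_lt/(_ e e0)[N _ HN] := @cvg_harmonic R.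
  exists N => n Nn; have := HN n Nn.
  by rewrite sub0r normrN ger0_norm ?invr_ge0.
have uu m n : nrm (ev b (P m) - ev b (P n)) <= m.+1%:R^-1 + n.+1%:R^-1.
  rewrite -poly_actB; apply: sa_nrm_le => // s s1.
  rewrite hornerD hornerN mulrBr.
  rewrite -[X in cmod X](subrKA (phi s)%:C%C) (le_trans (cmodD _ _))//.
  by rewrite -cmodN opprB lerD ?HP.
have [|c Hc] := complete (u := fun n => ev b (P n)).
  move=> e e0; have [|N HN] := inv_small (e / 2); first by rewrite divr_gt0.
  exists N => m n Nm Nn; rewrite (le_lt_trans (uu m n))//.
  by rewrite [e]splitr ltrD// HN.
exists c => e e0; have [N HN] := inv_small e e0; have [M HM] := Hc e e0.
exists (P (maxn N M)); split.
  by move=> s s1; rewrite (le_trans (HP _ s s1))// ltW// HN// leq_maxl.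
by rewrite -nrmN opprB ltW// HM// leq_maxr.
Qed.

End Calculus.

Let starB a b : star (a - b) = star a - star b.
Proof. by rewrite -scaleN1r starD starZ rmorphN1 scaleN1r. Qed.
Let mulBl a b c : mul (a - b) c = mul a c - mul b c.
Proof. by rewrite -scaleN1r mulDl mulZl scaleN1r. Qed.
Let mulBr a b c : mul a (b - c) = mul a b - mul a c.
Proof. by rewrite -scaleN1r mulDr mulZr scaleN1r. Qed.

(* An element [x] of square zero generates an image of the cone over the 2x2
   matrices, in which [x* x], [x x*], [x] stand for [t e11], [t e22],
   [sqrt t e21].  The vectors [(sqrt t, t)] and [(- t, sqrt t)] are orthogonal;
   [a] and [b] below are the corresponding rank one elements. *)
Lemma nilpotent_cone x : mul x x = 0 -> exists y s t a b,
  [/\ star s = s, star t = t, mul s t = 0 & mul t t = 0 -> x = 0] /\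
  [/\ star a = a, star b = b, mul a b = 0, mul a y = mul s y + mul t t &
      mul b y = mul s (mul s y) - mul t t].
Proof.
move=> xx; have [y sx'] : exists y, star x = y by exists (star x).
have sy' : star y = x by rewrite -sx' starK.
have yy : mul y y = 0.
  by rewrite -sx' -starM xx -(scale0r (0 : A)) starZ conjc0 !scale0r.
have [s yx] : exists s, mul y x = s by exists (mul y x).
have [t xy] : exists t, mul x y = t by exists (mul x y).
have ss : star s = s by rewrite -yx starM sx' sy'.
have st : star t = t by rewrite -xy starM sx' sy'.
have s_t : mul s t = 0 by rewrite -yx -xy mulA -(mulA y) xx mulx0 mul0x.
have sx : mul s x = 0 by rewrite -yx -mulA xx mulx0.
have ys : mul y s = 0 by rewrite -yx mulA yy mul0x.
have ty : mul t y = 0 by rewrite -xy -mulA yy mulx0.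
have ts : mul t s = 0 by rewrite -xy -mulA ys mulx0.
have xs : mul x s = mul t x by rewrite -yx -xy mulA.
have yt : mul y t = mul s y by rewrite -yx -xy mulA.
pose a := s + mul t x + mul s y + mul t t.
pose b := mul s s - mul t x - mul s y + t.
have sa : star a = a.
  rewrite /a !starD !starM ss st sx' sy' yt xs.
  by rewrite -!addrA; congr (_ + _); rewrite !addrA (addrC (mul s y)).
have sb : star b = b.
  rewrite /b starD !starB !starM ss st sx' sy' yt xs.
  by rewrite -(addrA _ (- mul s y)) (addrC (- mul s y)) addrA.
have xt : mul x t = 0 by rewrite -xy mulA xx mul0x.
have sB : mul s b = mul s (mul s s) - mul s (mul s y).
  by rewrite /b mulDr !mulBr s_t (mulA s t) s_t mul0x subr0 addr0.
have xB : mul x b = mul t (mul t x) - mul t t.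
  rewrite /b mulDr !mulBr xt (mulA x t) xt mul0x subr0 addr0 !(mulA x s) xs.
  by rewrite -!(mulA t x) xs xy.
have yB : mul y b = mul s y - mul s s.
  rewrite /b mulDr !mulBr !(mulA y s) ys !mul0x sub0r subr0 (mulA y t) yt.
  by rewrite -(mulA s y) yx addrC.
have tB : mul t b = mul t t - mul t (mul t x).
  by rewrite /b mulDr !mulBr !(mulA t s) ts !mul0x sub0r subr0 addrC.
have ab : mul a b = 0.
  rewrite /a !mulDl -!(mulA _ _ b) sB xB yB tB !mulBr.
  move: (mul s (mul s s)) (mul s (mul s y)) (mul t (mul t t)) => e1 e2 e3.
  move: (mul t (mul t (mul t x))) => e4.
  by rewrite -[LHS]addrA addrACA -(opprB e1 e2) subrr add0r -(opprB e4 e3) subrr.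
exists y, s, t, a, b; split; split => //.
- move=> tt0.
  have sq0 c : mul (star c) c = 0 -> c = 0.
    by move=> cc; apply: nrm_eq0; apply/eqP; rewrite -sqrf_eq0 -nrm_star_mul cc nrm0.
  have t0 : t = 0 by apply: sq0; rewrite st.
  by rewrite -sy' (sq0 y) ?star0// sy' xy.
- by rewrite /a !mulDl -!mulA xy yy ty !mulx0 !addr0.
- by rewrite /b mulDl !mulBl -!mulA xy yy ty !mulx0 subr0 addr0.
Qed.

(** * Commutativity in the absence of nilpotents *)

Section Reduced.
Context (reduced : forall x, mul x x = 0 -> x = 0).

Let comm (c y : A) := mul c y - mul y c.

Let commM c a b : comm c (mul a b) = mul (comm c a) b + mul a (comm c b).
Proof. by rewrite /comm mulBl mulBr !mulA addrA subrK. Qed.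

(* [comm c] is a derivation, so [0 = comm c (comm c (y* y))] reduces to
   [2 * comm c y* * comm c y]. *)
Lemma comm_comm_eq0 c : star c = c -> (forall y, comm c (comm c y) = 0) ->
  forall y, mul c y = mul y c.
Proof.
move=> sc cc0 y; apply/eqP; rewrite -subr_eq0; apply/eqP/nrm_eq0/eqP.
have H : mul (comm c (star y)) (comm c y) = 0.
  have := cc0 (mul (star y) y); rewrite commM.
  have -> a b : comm c (a + b) = comm c a + comm c b.
    by rewrite /comm mulDl mulDr opprD addrACA.
  rewrite !commM !cc0 mulx0 mul0x add0r addr0 => /eqP.
  by rewrite -mulr2n -scaler_nat scaler_eq0 pnatr_eq0 /= => /eqP.
have -> : nrm (mul c y - mul y c) = nrm (comm c y) by [].
rewrite -sqrf_eq0 -nrm_star_mul.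
have -> : star (comm c y) = - comm c (star y).
  by rewrite /comm -scaleN1r starD starZ !starM sc rmorphN1 scaleN1r opprB addrC.
by rewrite -scaleN1r mulZl H scaler0 nrm0.
Qed.

Section SmallRamps.
Context (n : nat) (e : R) (f : nat -> A).
Context (fmul : forall j k, (k < j)%N -> (j < n)%N ->
  mul (f j) (f k) = e%:C%C *: f j /\ mul (f k) (f j) = e%:C%C *: f j).

(** Each difference has the factor [f j] on one side and e - f k on the other. In its square these
    meet, and their product is 0 by [fmul]. *)
Let reduced_swap j k y : (k < j)%N -> (j < n)%N ->
  mul (mul (f j) y) (f k) = e%:C%C *: mul (f j) y /\
  mul (mul (f k) y) (f j) = e%:C%C *: mul y (f j).
Proof.
move=> kj jn; have [jk kj'] := fmul kj jn; split.
  apply/esym/eqP; rewrite -subr_eq0; apply/eqP/reduced.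
  set w := mul (f j) y; set x := _ - _.
  have xE : x = mul (f j) (e%:C%C *: y - mul y (f k)).
    by rewrite mulBr mulZr mulA.
  rewrite {1}/x mulBl mulZl -(mulA w) {2}xE (mulA (f k)) kj' mulZl -xE mulZr.
  exact: subrr.
apply/esym/eqP; rewrite -subr_eq0; apply/eqP/reduced.
set x := _ - _.
have xE : x = mul (e%:C%C *: y - mul (f k) y) (f j).
  by rewrite mulBl mulZl.
rewrite {1}xE -mulA {1}/x mulBr mulZr -(mulA (f k)) !(mulA (f j) (f k)) jk.
by rewrite mulZl subrr mulx0.
Qed.

(* The bilinear form in [a], [b] with [T c c y = comm c (comm c y)]. *)
Let T a b y := mul (mul a b) y - (mul (mul a y) b + mul (mul a y) b) +
  mul y (mul a b).

Let T_antisym j k y : (k < j)%N -> (j < n)%N -> T (f j) (f k) y + T (f k) (f j) y = 0.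
Proof.
move=> kj jn; have [jk kj'] := fmul kj jn.
have [s1 s2] := reduced_swap y kj jn.
rewrite /T jk kj' s1 s2 !mulZl !mulZr.
move: (_ *: mul (f j) y) (_ *: mul y (f j)) => a b.
by rewrite !opprD !addrA subrr add0r subrK (addrC _ b) subrK subrr.
Qed.

Lemma comm_sum_ramp y : 0 <= e -> (forall j, (j < n)%N -> nrm (f j) <= e) ->
  nrm (comm (\sum_(j < n) f j) (comm (\sum_(j < n) f j) y)) <=
    4 * n%:R * e ^+ 2 * nrm y.
Proof.
move=> e0 fe; set c := \sum_(j < n) f j.
have cE : comm c (comm c y) = \sum_(j < n) \sum_(k < n) T (f j) (f k) y.
  have -> : comm c (comm c y) = T c c y.
    rewrite /comm /T mulBl !mulBr !mulA opprB opprD.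
    by rewrite !addrA addrAC.
  have shuffle (a1 a2 b1 b2 c1 c2 : A) :
      a1 + a2 - (b1 + b2 + (b1 + b2)) + (c1 + c2) =
      a1 - (b1 + b1) + c1 + (a2 - (b2 + b2) + c2).
    by rewrite (addrACA b1) opprD [RHS]addrACA (addrACA a1).
  have TDl a1 a2 a3 : T (a1 + a2) a3 y = T a1 a3 y + T a2 a3 y.
    by rewrite /T !mulDl mulDr shuffle.
  have TDr a1 a2 a3 : T a1 (a2 + a3) y = T a1 a2 y + T a1 a3 y.
    by rewrite /T !(mulDr _ a2) mulDl mulDr shuffle.
  have T0l a3 : T 0 a3 y = 0 by rewrite /T !mul0x mulx0 !addr0 subrr.
  have T0r a1 : T a1 0 y = 0 by rewrite /T !mulx0 mul0x !addr0 subrr.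
  rewrite {1}/c (big_morph (fun a => T a c y) (id1 := 0) (op1 := +%R))//.
  apply: eq_bigr => j _.
  by rewrite /c (big_morph (fun a => T (f j) a y) (id1 := 0) (op1 := +%R)).
(* Doubling allows the term (j, k) to be added to (k, j) under a single double sum; [T_antisym]
   cancels every pair off the diagonal. Each of the n diagonal terms is then at most 4 e^2 nrm y. *)
have cE2 : comm c (comm c y) *+ 2 = (\sum_(j < n) T (f j) (f j) y) *+ 2.
  rewrite cE mulr2n {2}exchange_big -big_split /= -sumrMnl.
  apply: eq_bigr => j _; rewrite -big_split /= (bigD1 j)//= big1 ?addr0 ?mulr2n//.
  move=> k kj; have [kj'|jk|E] := ltngtP k j.
  - exact: T_antisym.
  - by rewrite addrC; exact: T_antisym.
  - by rewrite (val_inj E) eqxx in kj.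
have -> : comm c (comm c y) = \sum_(j < n) T (f j) (f j) y.
  apply/eqP; rewrite -subr_eq0; move/eqP: cE2; rewrite -subr_eq0 -mulrnBl.
  by rewrite -scaler_nat scaler_eq0 pnatr_eq0.
have nrm_sum m (F : nat -> A) M : (forall j, (j < m)%N -> nrm (F j) <= M) ->
    nrm (\sum_(j < m) F j) <= m%:R * M.
  elim: m => [|m IH] HF; first by rewrite big_ord0 nrm0 mul0r.
  rewrite big_ord_recr /= (le_trans (nrmD _ _))// -natr1 mulrDl mul1r lerD//.
    by apply: IH => j jm; apply: HF; rewrite ltnS ltnW.
  exact: HF.
rewrite (_ : 4 * _ * _ * _ = n%:R * (4 * e ^+ 2 * nrm y)); last by ring.
apply: (nrm_sum n (fun j => T (f j) (f j) y)) => j jn.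
have ffy a1 a2 a3 x1 x2 x3 : nrm a1 <= x1 -> nrm a2 <= x2 -> nrm a3 <= x3 ->
    nrm (mul (mul a1 a2) a3) <= x1 * x2 * x3.
  move=> h1 h2 h3; rewrite (le_trans (nrmM _ _))// ler_pM// (le_trans (nrmM _ _))//.
  by rewrite ler_pM.
have fj := fe j jn.
rewrite /T mulA (le_trans (nrmD _ _))// (le_trans (lerD (nrmD _ _) (lexx _)))// nrmN.
rewrite (le_trans (lerD (lerD (lexx _) (nrmD _ _)) (lexx _)))//.
have := ffy _ _ _ _ _ _ fj fj (lexx (nrm y)).
have := ffy _ _ _ _ _ _ fj (lexx (nrm y)) fj.
have := ffy _ _ _ _ _ _ (lexx (nrm y)) fj fj.
rewrite expr2; lra.
Qed.

End SmallRamps.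

Lemma ramp_central b u c : star b = b -> nrm b <= 1 -> `|u| = 1 ->
  fcalc b (ramp u 0 1) c -> forall y, mul c y = mul y c.
Proof.
move=> sb b1 u1 Hc; apply: comm_comm_eq0; first exact: (fcalc_star sb b1 Hc).
move=> y; apply: nrm_eq0; apply/eqP; rewrite eq_le nrm_ge0 andbT.
apply/ler_addgt0Pr => d d0; rewrite add0r.
(* With N ramps of height e = 1 / N the bound of [comm_sum_ramp] becomes 4 nrm y / N, to be at most
   d. *)
pose N := (Num.bound (4 * nrm y / d)).+1.
have N0 : 0 < N%:R :> R by rewrite ltr0n.
have Nd : 4 * nrm y <= d * N%:R.
  have q0 : 0 <= 4 * nrm y / d by rewrite divr_ge0 ?mulr_ge0// ltW.
  rewrite [d * _]mulrC -ler_pdivrMr// ltW// (lt_le_trans (archi_boundP q0))//.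
  by rewrite ler_nat.
pose e : R := N%:R^-1.
have e0 : 0 < e by rewrite invr_gt0.
have Ne : N%:R * e = 1 by rewrite mulfV// gt_eqF.
have le_step j k : (j <= k)%N -> j%:R * e <= k%:R * e.
  by move=> jk; rewrite ler_pM2r// ler_nat.
have je j : (j <= N)%N -> 0 <= j%:R * e <= 1.
  by move=> jN; rewrite mulr_ge0 ?(ltW e0)//=; have := le_step j N jN; rewrite Ne.
have step j : j.+1%:R * e - j%:R * e = e by rewrite -natr1; ring.
pose r j := ramp u (j%:R * e) (j.+1%:R * e).
have rb j s : 0 <= r j s <= e.
  by have := @ramp_ge0 R u _ _ s u1 (le_step j j.+1 (leqnSn j)); rewrite step.
have fex j : exists fj, (j < N)%N -> fcalc b (r j) fj.
  have [jN|] := ltnP j N; last by move=> Nj; exists 0.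
  have [|fj Hfj] := fcalc_exists sb b1 (phi := r j).
    by apply: ramp_approximable => //; apply: je => //; exact: ltnW.
  by exists fj.
have [f Hf] := choice fex.
have e1 : e <= 1 by rewrite invf_le1// ler1n.
have r1 j s : `|s| <= 1 -> `|r j s| <= 1.
  by move=> _; have /andP[? ?] := rb j s; rewrite ger0_norm//; lra.
have cE : c = \sum_(j < N) f j.
  have Hsum m : (m <= N)%N ->
      fcalc b (fun s => \sum_(j < m) r j s) (\sum_(j < m) f j).
    elim: m => [_|m IH mN].
      rewrite big_ord0; apply: (fcalc_ext _ (fcalc0 b)) => s _.
      by rewrite big_ord0.
    have := fcalc_lin 1 (Hf m mN) (IH (ltnW mN)).
    rewrite rmorph1 scale1r big_ord_recr /= addrC; apply: fcalc_ext => s _.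
    by rewrite big_ord_recr /= mul1r addrC.
  apply: (fcalc_uniq sb b1 Hc); apply: fcalc_ext (Hsum N (leqnn N)) => s _.
  by rewrite ramp_telescope// Ne.
have fmul j k : (k < j)%N -> (j < N)%N ->
    mul (f j) (f k) = e%:C%C *: f j /\ mul (f k) (f j) = e%:C%C *: f j.
  move=> kj jN; have kN := ltn_trans kj jN.
  have He : fcalc b (fun s => e * r j s) (e%:C%C *: f j).
    have := fcalc_lin e (Hf j jN) (fcalc0 b).
    by rewrite addr0; apply: fcalc_ext => s _; rewrite addr0.
  have dis s : r j s * r k s = e * r j s.
    by rewrite /r ramp_disjoint ?step// le_step.
  split; apply: (fcalc_uniq sb b1 _ He).
    apply: fcalc_ext (fcalc_mul sb b1 (r1 j) (r1 k) (Hf j jN) (Hf k kN)).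
    by move=> s _; exact: dis.
  apply: fcalc_ext (fcalc_mul sb b1 (r1 k) (r1 j) (Hf k kN) (Hf j jN)).
  by move=> s _; rewrite mulrC; exact: dis.
have fe j : (j < N)%N -> nrm (f j) <= e.
  move=> jN; apply: (fcalc_nrm_le sb b1 (Hf j jN)) => s _.
  by have /andP[? ?] := rb j s; rewrite ger0_norm.
rewrite cE (le_trans (comm_sum_ramp fmul y (ltW e0) fe))//.
rewrite (_ : _ * _ * _ * _ = 4 * nrm y * e * (N%:R * e)); last by ring.
by rewrite Ne mulr1 ler_pdivrMr.
Qed.

Lemma sa_central b : star b = b -> forall y, mul b y = mul y b.
Proof.
move=> sb y; have [b0|b0] := eqVneq (nrm b) 0.
  by rewrite (nrm_eq0 b0) mulx0 mul0x.
have {}b0 : 0 < nrm b by rewrite lt_def b0 nrm_ge0.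
pose k := (nrm b)%:C%C; pose a := k^-1 *: b.
have k0 : k != 0 by rewrite fmorph_eq0 gt_eqF.
have ba : b = k *: a by rewrite scalerA mulfV// scale1r.
have sa : star a = a by rewrite starZ sb conjc_inv conjc_real.
have a1 : nrm a <= 1.
  by rewrite nrmZ cmodV cmod_real ger0_norm// mulVf// gt_eqF.
(* The signs u = 1 and u = -1 give the positive and the negative part of [a], since [ramp_pos_neg]
   recovers the identity on [-1, 1]. *)
have ex u : `|u| = 1 -> exists c, fcalc a (ramp u 0 1) c.
  move=> u1; apply: (fcalc_exists sa a1).
  by apply: ramp_approximable => //; rewrite lexx ler01.
have [c Hc] := ex 1 (normr1 _).
have n1 : `|- 1 : R| = 1 by rewrite normrN1.
have [d Hd] := ex _ n1.
have aE : a = c - d.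
  apply: (fcalc_uniq sa a1 (fcalc_id a)).
  have := fcalc_lin (-1) Hd Hc.
  rewrite rmorphN1 scaleN1r addrC; apply: fcalc_ext => s s1.
  by rewrite mulN1r addrC ramp_pos_neg.
have cC := ramp_central sa a1 (normr1 _) Hc y.
have dC := ramp_central sa a1 n1 Hd y.
by rewrite ba mulZl mulZr aE mulBl mulBr cC dC.
Qed.

Lemma reduced_commutative : commutative_alg mul.
Proof.
move=> a b.
pose h := 2^-1 *: (a + star a); pose k := ('i / 2%:R)%C *: (star a - a).
have sh : star h = h.
  rewrite starZ starD starK addrC; congr (_ *: _).
  by rewrite conjc_inv conjc_nat.
have sk : star k = k.
  rewrite starZ -scaleN1r starD starZ starK rmorphN1.
  have -> : (('i / 2%:R)^*)%C = - ('i / 2%:R)%C :> R[i].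
    by rewrite rmorphM fmorphV rmorph_nat -mulNr; congr (_ / _); simpc.
  by rewrite scaleN1r scaleNr -scalerN opprB.
have aE : a = h + ('i)%C *: k.
  rewrite /h /k scalerA mulrA -expr2 sqr_i mulN1r scaleNr -scalerN opprB -scalerDr.
  by rewrite addrACA subrr addr0 -[a + a]mulr2n -[a *+ 2]scaler_nat scalerA mulVf ?scale1r//.
have hb := sa_central sh b; have kb := sa_central sk b.
clearbody h k; by rewrite aE mulDl mulDr mulZl mulZr hb kb.
Qed.

End Reduced.

End CStarAlgebra.

(** * Complex L^p-spaces and the discrete representation *)

Section ComplexMeasurable.
Context {R : realType} {d : measure_display} {T : measurableType d}.
Implicit Types f g : T -> R[i].

Definition cmeasurable f :=
  measurable_fun setT (fun x => complex.Re (f x)) /\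
  measurable_fun setT (fun x => complex.Im (f x)).

Lemma cmeasurableD f g : cmeasurable f -> cmeasurable g ->
  cmeasurable (fun x => f x + g x).
Proof.
move=> [fR fI] [gR gI]; split.
  rewrite (_ : (fun _ => _) = (fun x => complex.Re (f x) + complex.Re (g x))).
    exact: measurable_funD.
  by apply/funext => x; case: (f x) (g x) => ? ? [].
rewrite (_ : (fun _ => _) = (fun x => complex.Im (f x) + complex.Im (g x))).
  exact: measurable_funD.
by apply/funext => x; case: (f x) (g x) => ? ? [].
Qed.

Lemma cmeasurableM f g : cmeasurable f -> cmeasurable g ->
  cmeasurable (fun x => f x * g x).
Proof.
move=> [fR fI] [gR gI]; split.
  rewrite (_ : (fun _ => _) = (fun x => complex.Re (f x) * complex.Re (g x) -
     complex.Im (f x) * complex.Im (g x))).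
    by apply: measurable_funB; exact: measurable_funM.
  by apply/funext => x; case: (f x) (g x) => ? ? [].
rewrite (_ : (fun _ => _) = (fun x => complex.Re (f x) * complex.Im (g x) +
     complex.Im (f x) * complex.Re (g x))).
  by apply: measurable_funD; exact: measurable_funM.
by apply/funext => x; case: (f x) (g x) => ? ? [].
Qed.

Lemma cmeasurable_cst (k : R[i]) : cmeasurable (fun=> k).
Proof. by split; exact: measurable_cst. Qed.

Lemma cmeasurable_real (u : T -> R) : measurable_fun setT u ->
  cmeasurable (fun x => (u x)%:C%C).
Proof. by move=> mu; split => //=; exact: measurable_cst. Qed.

Lemma cmeasurable_conj f : cmeasurable f -> cmeasurable (fun x => ((f x)^*)%C).
Proof.
move=> [fR fI]; split.
  by rewrite (_ : (fun _ => _) = (fun x => complex.Re (f x)))//;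
    apply/funext => x; case: (f x).
rewrite (_ : (fun _ => _) = (fun x => - complex.Im (f x))).
  exact: measurableT_comp.
by apply/funext => x; case: (f x).
Qed.

Lemma measurable_cmod f : cmeasurable f -> measurable_fun setT (fun x => cmod (f x)).
Proof.
move=> [fR fI].
rewrite (_ : (fun _ => _) = Num.sqrt \o
    (fun x => complex.Re (f x) ^+ 2 + complex.Im (f x) ^+ 2)).
  apply: measurableT_comp.
    by apply: continuous_measurable_fun => x; exact: sqrt_continuous.
  by apply: measurable_funD; apply: measurable_funX.
by apply/funext => x /=; case: (f x).
Qed.

End ComplexMeasurable.

Section ComplexLp.
Context {R : realType} {d : measure_display} {T : measurableType d}
  (mu : {measure set T -> \bar R}) (p : R) (p1 : 1 <= p).
Implicit Types f g : T -> R[i].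

Let p0 : 0 < p. Proof. exact: lt_le_trans p1. Qed.

Lemma cLp_measurable f : cLp mu p f -> cmeasurable f.
Proof. by case. Qed.

Lemma cLpnormE f :
  cLpnorm mu p f = ((\int[mu]_x (cmod (f x) `^ p)%:E) `^ p^-1)%E.
Proof.
rewrite /cLpnorm unlock; apply: (congr1 (fun I => I `^ p^-1)%E).
by apply: eq_integral => x _; rewrite /= ger0_norm ?cmod_ge0.
Qed.

Lemma cLpnorm_ge0 f : (0 <= cLpnorm mu p f)%E.
Proof. exact: Lnorm_ge0. Qed.

Lemma cLpnorm_powR f :
  (cLpnorm mu p f `^ p)%E = (\int[mu]_x (cmod (f x) `^ p)%:E)%E.
Proof.
rewrite cLpnormE -poweRrM mulVf ?gt_eqF// poweRe1//.
by apply: integral_ge0 => x _; rewrite lee_fin powR_ge0.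
Qed.

Let measurable_cmod_powR f : cmeasurable f ->
  measurable_fun setT (fun x => (cmod (f x) `^ p)%:E).
Proof.
move=> mf; apply/measurable_EFinP.
by apply: (measurableT_comp (measurable_powR p)); exact: measurable_cmod.
Qed.

Lemma cLpnorm_le f g (c : R) : 0 <= c -> cmeasurable f -> cmeasurable g ->
  (forall x, cmod (f x) <= c * cmod (g x)) ->
  (cLpnorm mu p f <= c%:E * cLpnorm mu p g)%E.
Proof.
move=> c0 mf mg fg; have cE : c%:E = ((c `^ p)%:E `^ p^-1)%E.
  by rewrite poweR_EFin -powRrM mulfV ?gt_eqF// powRr1.
rewrite !cLpnormE cE -poweRM ?lee_fin ?powR_ge0//; last first.
  by apply: integral_ge0 => x _; rewrite lee_fin powR_ge0.
rewrite -ge0_integralZl_EFin ?powR_ge0//; last 2 first.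
- by move=> x _; rewrite lee_fin powR_ge0.
- exact: measurable_cmod_powR.
have i0 (F : T -> R) : (forall x, 0 <= F x) ->
    (\int[mu]_x (F x)%:E)%E \in `[0%E, +oo%E].
  by move=> F0; rewrite in_itv/= leey andbT integral_ge0// => x _; rewrite lee_fin.
apply: gt0_ler_poweR; rewrite ?invr_ge0 ?(ltW p0)//.
- by apply: i0 => x; exact: powR_ge0.
- rewrite (_ : (fun x => _) = (fun x => (c `^ p * cmod (g x) `^ p)%:E)).
    by apply: i0 => x; rewrite mulr_ge0 ?powR_ge0.
  by apply/funext => x; rewrite EFinM.
apply: ge0_le_integral => //.
- by move=> x _; rewrite lee_fin powR_ge0.
- exact: measurable_cmod_powR.
- by apply: measurable_funeM; exact: measurable_cmod_powR.
- move=> x _; rewrite -EFinM lee_fin -powRM ?cmod_ge0//.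
  by rewrite ge0_ler_powR ?(ltW p0)// ?nnegrE ?mulr_ge0 ?cmod_ge0.
Qed.

Lemma cLp_le f g (c : R) : 0 <= c -> cmeasurable f -> cLp mu p g ->
  (forall x, cmod (f x) <= c * cmod (g x)) -> cLp mu p f.
Proof.
move=> c0 [fR fI] [gR gI gfin] fg; split => //.
apply: (le_lt_trans (cLpnorm_le c0 _ _ fg)) => //.
rewrite muleC lte_mul_pinfty ?cLpnorm_ge0//.
  by rewrite ge0_fin_numE ?cLpnorm_ge0.
exact: ltry.
Qed.

Lemma cLpnorm_ae f g : cmeasurable f -> cmeasurable g ->
  {ae mu, forall x, f x = g x} -> cLpnorm mu p f = cLpnorm mu p g.
Proof.
move=> mf mg fg; rewrite !cLpnormE; apply: (congr1 (fun I => I `^ p^-1)%E).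
apply: ge0_ae_eq_integral => //; [exact: measurable_cmod_powR
  |exact: measurable_cmod_powR| | |].
- by move=> x _; rewrite lee_fin powR_ge0.
- by move=> x _; rewrite lee_fin powR_ge0.
- by apply: filterS fg => x -> _.
Qed.

Lemma cLpnormD f g : cmeasurable f -> cmeasurable g ->
  (cLpnorm mu p (fun x => (f x + g x)%R) <= cLpnorm mu p f + cLpnorm mu p g)%E.
Proof.
move=> mf mg.
have mfg := cmeasurableD mf mg.
apply: le_trans (minkowski_EFin mu (measurable_cmod mf) (measurable_cmod mg) p1).
pose h x : R[i] := (cmod (f x) + cmod (g x))%:C%C.
have mh : cmeasurable h.
  by apply: cmeasurable_real; apply: measurable_funD; exact: measurable_cmod.
rewrite (_ : Lnorm _ _ _ = cLpnorm mu p h).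
  rewrite -[leRHS]mul1e; apply: cLpnorm_le => // x; rewrite mul1r.
  by rewrite cmod_real ger0_norm ?addr_ge0 ?cmod_ge0// cmodD.
rewrite /cLpnorm; apply: eq_Lnorm => x.
by rewrite /h cmod_real ger0_norm// addr_ge0 ?cmod_ge0.
Qed.

Lemma cLpD f g : cLp mu p f -> cLp mu p g -> cLp mu p (fun x => f x + g x).
Proof.
move=> [fR fI fL] [gR gI gL].
have [mR mI] : cmeasurable (fun x => f x + g x) by exact: cmeasurableD.
split => //; apply: le_lt_trans (cLpnormD _ _) _ => //.
exact: lte_add_pinfty.
Qed.

Lemma cLpZ (k : R[i]) f : cLp mu p f -> cLp mu p (fun x => k * f x).
Proof.
move=> Lf; apply: (@cLp_le _ f (cmod k)) => //; first exact: cmod_ge0.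
  by apply: cmeasurableM; [exact: cmeasurable_cst|exact: cLp_measurable].
by move=> x; rewrite cmodM.
Qed.

Lemma cLpnormZ (k : R[i]) f : cLp mu p f ->
  cLpnorm mu p (fun x => k * f x) = ((cmod k)%:E * cLpnorm mu p f)%E.
Proof.
move=> Lf; have mf := cLp_measurable Lf.
have mk : cmeasurable (fun x => k * f x) := cLp_measurable (cLpZ k Lf).
apply/eqP; rewrite eq_le; apply/andP; split.
  by apply: cLpnorm_le => //; [exact: cmod_ge0|move=> x; rewrite cmodM].
have [->|k0] := eqVneq k 0; first by rewrite cmod0 mul0e cLpnorm_ge0.
have ck0 : 0 < cmod k.
  by rewrite lt_def cmod_ge0 andbT; apply: contra_neq k0 => /cmod_eq0.
rewrite -lee_pdivlMl//; apply: cLpnorm_le => //; first by rewrite invr_ge0 ltW.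
by move=> x; rewrite cmodM mulKf// gt_eqF.
Qed.

Lemma cLp0 : cLp mu p (fun=> 0).
Proof.
split; [exact: measurable_cst|exact: measurable_cst|].
rewrite /cLpnorm (_ : (fun _ => _) = cst 0%E).
  by rewrite Lnorm0 ?eqe ?gt_eqF// ltry.
by apply/funext => x; rewrite cmod0.
Qed.

End ComplexLp.

(** An alias of [A] that carries the discrete sigma-algebra; its points index the characters. *)
Definition discrete_space (R : realType) (A : lmodType R[i]) : Type := A.

HB.instance Definition _ (R : realType) (A : lmodType R[i]) :=
  Choice.on (discrete_space A).
HB.instance Definition _ (R : realType) (A : lmodType R[i]) :=
  isPointed.Build (discrete_space A) (0 : A).
HB.instance Definition _ (R : realType) (A : lmodType R[i]) :=
  @isMeasurable.Build default_measure_display (discrete_space A)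
    discrete_measurable discrete_measurable0
    discrete_measurableC discrete_measurableU.

Section DiscreteLp.
Context {R : realType} {A : lmodType R[i]} (p : R) (p1 : 1 <= p).
Local Notation T := (discrete_space A).
Local Notation mu := (@counting T R).

Lemma discrete_cmeasurable (f : T -> R[i]) : cmeasurable f.
Proof. by split. Qed.

Lemma cLpnorm_point (a : T) : cLpnorm mu p (fun x => (x == a)%:R) = 1%E.
Proof.
rewrite cLpnormE.
rewrite (_ : (\int[_]_x _)%E = (\int[mu]_x (\1_[set a] x)%:E)%E); last first.
  apply: eq_integral => x _; congr (_%:E); rewrite indicE.
  have [->|/eqP xa] := eqVneq x a; first by rewrite mem_set// cmod1 powR1.
  by rewrite memNset// cmod0 powR0// gt_eqF// (lt_le_trans _ p1).
rewrite integral_indic// setIT /= /counting asboolT; last exact: finite_set1.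
by rewrite fset_set1 finmap.cardfs1 poweR1r.
Qed.

Lemma cLp_point (a : T) : cLp mu p (fun x => (x == a)%:R).
Proof. by split => //; rewrite cLpnorm_point ltry. Qed.

End DiscreteLp.

Section CommutativeRep.
Context {R : realType} {A : lmodType R[i]} (mul : A -> A -> A) (star : A -> A)
  (nrm : A -> R).
Context (HA : is_cstar_algebra mul star nrm).

Lemma commutative_has_rep (p : R) : 1 <= p ->
  commutative_alg mul -> has_isometric_Lp_rep p mul nrm.
Proof.
move=> p1 mulC.
have [[mulA mulD mulZ] [[N0 NZ ND] [_ [NM _]]]] := HA.
have pm : power_mult_seminorm mul nrm.
  by split => // x; apply: (cstar_normal_sqr HA); exact: mulC.
have [chi chiP] := choice (fun a => exists_character mulA mulC
  (fun a b c => (mulD a b c).1) (fun k a b => (mulZ k a b).1) a pm).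
exists default_measure_display, (discrete_space A), (@counting (discrete_space A) R).
pose pi (a : A) (f : discrete_space A -> R[i]) x := chi x a * f x.
exists pi.
have pile a f x : cmod (pi a f x) <= nrm a * cmod (f x).
  by rewrite cmodM ler_wpM2r ?cmod_ge0//; case: (chiP x).
have nrm_ge0 := cstar_nrm_ge0 HA.
split.
- move=> a; split.
  + by move=> f Lf; apply: (cLp_le p1 (nrm_ge0 a) _ Lf) => //; exact: discrete_cmeasurable.
  + by move=> f g _ _; apply: filterS => x; rewrite /pi => ->.
  + by move=> k f g _ _; apply: nearW => x; rewrite /pi; ring.
  + by exists (nrm a) => f Lf; apply: cLpnorm_le => //; exact: discrete_cmeasurable.
- move=> k a b f _; apply: nearW => x; rewrite /pi.
  by case: (chiP x) => -> _ _ _; ring.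
- move=> a b f _; apply: nearW => x; rewrite /pi.
  by case: (chiP x) => _ -> _ _; ring.
- move=> a; apply/eqP; rewrite eq_le; apply/andP; split.
  + apply: ge_ereal_sup => _ [f [Lf f1] <-].
    have le : (cLpnorm (@counting (discrete_space A) R) p (pi a f) <=
        (nrm a)%:E * cLpnorm (@counting (discrete_space A) R) p f)%E.
      by apply: cLpnorm_le => //; exact: discrete_cmeasurable.
    by rewrite (le_trans le)// -[leRHS]mule1 lee_wpmul2l// lee_fin.
  (* The point mass at [a] attains the norm, because the character at [a] was chosen with modulus
     [nrm a] at [a]. *)
  + apply: ereal_sup_ubound; exists (fun x => (x == a)%:R).
      by split; [exact: cLp_point|rewrite cLpnorm_point].
    rewrite (_ : pi a _ = fun x => chi a a * (x == a)%:R).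
      rewrite cLpnormZ//; last exact: cLp_point.
      by rewrite cLpnorm_point// mule1; case: (chiP a) => _ _ _ ->.
    apply/funext => x; rewrite /pi.
    by have [->//|_] := eqVneq x a; rewrite !mulr0.
Qed.

End CommutativeRep.

(** * Second order expansion of the p-th power of the modulus *)

Import numFieldNormedType.Exports.

Section PowerTaylor.
Context {R : realType}.
Implicit Types r x : R.

Lemma mvt_at0 (f df : R -> R) (d : R) :
  (forall x, `|x| <= d -> is_derive x 1 f (df x)) -> f 0 = 0 ->
  forall x, `|x| <= d -> exists2 c, `|c| <= `|x| & f x = df c * x.
Proof.
move=> fdf f0 x xd.
have cont (a b : R) : `|a| <= d -> `|b| <= d -> {within `[a, b], continuous f}.
  rewrite !ler_norml => /andP[a1 a2] /andP[b1 b2].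
  apply: derivable_within_continuous => y; rewrite in_itv/= => /andP[ay yb].
  have yd : `|y| <= d by rewrite ler_norml; lra.
  by have := fdf y yd => H; exact: ex_derive.
have d0 : `|0 : R| <= d by rewrite normr0 (le_trans _ xd).
have dx (a b : R) : `|a| <= d -> `|b| <= d ->
    forall y, y \in `]a, b[%R -> is_derive y 1 f (df y).
  rewrite !ler_norml => /andP[a1 a2] /andP[b1 b2] y.
  by rewrite in_itv/= => /andP[ay yb]; apply: fdf; rewrite ler_norml; lra.
have [x0|/ltW x0] := leP 0 x.
  have [c] := MVT_segment x0 (dx _ _ d0 xd) (cont _ _ d0 xd).
  rewrite in_itv/= f0 !subr0 => /andP[c0 cx] E; exists c => //.
  by rewrite !ger0_norm.
have [c] := MVT_segment x0 (dx _ _ xd d0) (cont _ _ xd d0).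
rewrite in_itv/= f0 !sub0r => /andP[cx c0] E; exists c.
  by rewrite !ler0_norm// lerN2.
by apply: oppr_inj; rewrite E; ring.
Qed.

Lemma is_derive_powR1p r x : `|x| < 1 ->
  is_derive x 1 (fun y => (1 + y) `^ r) (r * (1 + x) `^ (r - 1)).
Proof.
rewrite ltr_norml => /andP[x1 _].
have x0 : 0 < 1 + x by lra.
have H : is_derive x (1 : R) (fun y : R => 1 + y) (1 : R).
  by apply: is_derive_eq; rewrite add0r mulr1.
have H' := is_derive1_powR r x0.
have := @is_derive1_comp R (fun y => y `^ r) (fun y => 1 + y) x _ _ H' H.
by rewrite mulr1.
Qed.

(** Two mean value steps: the remainder phi has derivative r psi, and psi has derivative (r - 1) ((1
    + x)^(r - 2) - 1), which is small near 0. The radius at most 1/2 keeps 1 + x positive. *)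
Lemma powR1p_taylor2 r (e : R) : 0 < e -> exists2 d, 0 < d <= 2^-1 &
  forall x, `|x| <= d ->
    `|(1 + x) `^ r - 1 - r * x - r * (r - 1) / 2 * x ^+ 2| <= e * x ^+ 2.
Proof.
move=> e0.
pose q := e / (`|r| * `|r - 1| + 1).
have k0 : 0 < `|r| * `|r - 1| + 1 by rewrite ltr_wpDl.
have q0 : 0 < q by rewrite divr_gt0.
have qe : `|r| * `|r - 1| * q <= e.
  have E : q * (`|r| * `|r - 1| + 1) = e by rewrite divfK// gt_eqF.
  by rewrite -E mulrC; rewrite ler_pM2l//; lra.
have cont : {for (0 : R), continuous (fun y : R => (1 + y) `^ (r - 2))}.
  apply: differentiable_continuous; apply/derivable1_diffP.
  have n0 : `|0 : R| < 1 by rewrite normr0.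
  by have := is_derive_powR1p (r - 2) n0 => H; exact: ex_derive.
have [d1 d10 Hd1] : exists2 d, 0 < d &
    forall x, `|x| <= d -> `|(1 + x) `^ (r - 2) - 1| <= q.
  move/cvgrPdist_le : cont => /(_ q q0) /nbhs_ballP[d /= d0 Hd].
  exists (d / 2); first by rewrite divr_gt0.
  move=> x xd; have := Hd x; rewrite addr0 powR1 distrC; apply.
  by rewrite /ball /= sub0r normrN; lra.
pose d := Num.min d1 2^-1.
have h0 : 0 < 2^-1 :> R by rewrite invr_gt0.
have d0 : 0 < d by rewrite lt_min d10 h0.
have dh : d <= 2^-1 by rewrite ge_min lexx orbT.
have dd1 : d <= d1 by rewrite ge_min lexx.
exists d; first by rewrite d0.
have lt1 x : `|x| <= d -> `|x| < 1 by lra.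
pose psi x := (1 + x) `^ (r - 1) - 1 - (r - 1) * x.
pose phi x := (1 + x) `^ r - 1 - r * x - r * (r - 1) / 2 * x ^+ 2.
have Dpsi x : `|x| <= d ->
    is_derive x 1 psi ((r - 1) * ((1 + x) `^ (r - 2) - 1)).
  move=> /lt1 /(is_derive_powR1p (r - 1)) H.
  apply: is_derive_eq; rewrite /GRing.scale /=.
  rewrite (_ : r - 1 - 1 = r - 2); last by ring.
  by ring.
have Dphi x : `|x| <= d -> is_derive x 1 phi (r * psi x).
  move=> /lt1 /(is_derive_powR1p r) H.
  apply: is_derive_eq; rewrite /GRing.scale /= /psi.
  by field.
have psi0 : psi 0 = 0 by rewrite /psi addr0 powR1 mulr0 subr0 subrr.
have phi0 : phi 0 = 0 by rewrite /phi addr0 powR1 expr0n /= !mulr0 !subr0 subrr.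
move=> x xd; rewrite -/(phi x).
have [c cx ->] := mvt_at0 Dphi phi0 xd.
have cd : `|c| <= d by rewrite (le_trans cx).
have [c' c'c ->] := mvt_at0 Dpsi psi0 cd.
have c'd : `|c'| <= d1 by rewrite (le_trans c'c)// (le_trans cd).
have := Hd1 c' c'd; set w := `|_ - 1| => wq.
rewrite !normrM -/w -[x ^+ 2]real_normK ?num_real//.
apply: le_trans (ler_wpM2r (sqr_ge0 _) qe).
rewrite [leLHS](_ : _ = `|r| * `|r - 1| * (w * (`|c| * `|x|))); last by ring.
rewrite -[leRHS]mulrA ler_wpM2l ?mulr_ge0// expr2.
have cxx : `|c| * `|x| <= `|x| * `|x| by rewrite ler_wpM2r.
by apply: ler_pM => //; rewrite ?mulr_ge0 ?normr_ge0.
Qed.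

End PowerTaylor.

Section FourPoints.
Context {R : realType}.
Implicit Types r t a b : R.

(* [|1 + z + t * conj z|^2 - 1] for [z = a + i b] *)
Definition defect t a b : R :=
  2 * (1 + t) * a + ((1 + t) ^+ 2 * a ^+ 2 + (1 - t) ^+ 2 * b ^+ 2).

(** The sum of |1 + y + t conj y|^(2 r) over y = z, i z, - z, - i z, where z = a + i b. *)
Definition four_sum r t a b : R :=
  (1 + defect t a b) `^ r + (1 + defect t (- b) a) `^ r +
  ((1 + defect t (- a) (- b)) `^ r + (1 + defect t b (- a)) `^ r).

Lemma sqr_le4 t : `|t| <= 1 -> (1 + t) ^+ 2 <= 4 /\ (1 - t) ^+ 2 <= 4.
Proof. rewrite ler_norml => /andP[? ?]; rewrite !expr2; split; nra. Qed.

Lemma defect_sqr_le t a b : `|t| <= 1 -> a ^+ 2 + b ^+ 2 <= 1 ->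
  defect t a b ^+ 2 <= 64 * (a ^+ 2 + b ^+ 2).
Proof.
move=> t1 w1; have [t4 t4'] := sqr_le4 t1.
set w := a ^+ 2 + b ^+ 2 in w1 *.
have a0 := sqr_ge0 a; have b0 := sqr_ge0 b.
set q := (1 + t) ^+ 2 * a ^+ 2 + (1 - t) ^+ 2 * b ^+ 2.
have q0 : 0 <= q by rewrite addr_ge0// mulr_ge0 ?sqr_ge0.
have qw : q <= 4 * w by rewrite /q /w mulrDr lerD// ler_wpM2r.
have q2 : q ^+ 2 <= 16 * w.
  rewrite (@le_trans _ _ ((4 * w) ^+ 2))//; first by rewrite lerXn2r ?nnegrE//; lra.
  by rewrite expr2; nra.
have -> : defect t a b = 2 * (1 + t) * a + q by [].
have A : (2 * (1 + t) * a) ^+ 2 <= 16 * w.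
  rewrite !exprMn; have : (1 + t) ^+ 2 * a ^+ 2 <= 4 * a ^+ 2 by rewrite ler_wpM2r.
  by rewrite /w; lra.
move: (2 * (1 + t) * a) A => x A; clearbody q w.
have := sqr_ge0 (x - q); rewrite !expr2 in A q2 *; lra.
Qed.

(* With [t = (1 - r) / r] the second order terms of the two sides differ by
   [4 (r - 1)^2 |z|^2], and all the odd order terms cancel. *)
Lemma four_sum_lt r : 2^-1 <= r -> r != 1 -> exists2 k, 0 < k &
  forall a b, 0 < a ^+ 2 + b ^+ 2 <= k ->
    four_sum r ((1 - r) / r) a b < four_sum r 0 a b.
Proof.
(* The second order change is 4 w ((r t)^2 + 2 (r - 1) (r t)) with w = |z|^2, minimal at r t = 1 -
   r. The bound r >= 1/2 gives t <= 1. *)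
move=> r2 r1; set t := (1 - r) / r.
have r0 : 0 < r by lra.
have rt : r * t = 1 - r by rewrite mulrC divfK// gt_eqF.
have t1 : `|t| <= 1.
  rewrite ler_norml; apply/andP; split; first by rewrite /t ler_pdivlMr//; lra.
  by rewrite /t ler_pdivrMr//; lra.
have t10 : `|0 : R| <= 1 by rewrite normr0.
pose m := (r - 1) ^+ 2.
have m0 : 0 < m by rewrite lt_def sqr_ge0 andbT sqrf_eq0 subr_eq0.
(* As the squared defect is at most 64 w, each Taylor remainder is at most m w / 8. The four on both
   sides together cost m w out of the gain 4 m w. *)
have m512 : 0 < m / 512 by rewrite divr_gt0 ?m0 ?ltr0n.
have [d /andP[d0 _] Hd] := powR1p_taylor2 r m512.
pose g := `|r * (r - 1)|.
have g0 : 0 <= g by rewrite normr_ge0.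
have k3 : 0 < m / (32 * g + 1) by rewrite divr_gt0//; lra.
(* The bound 1 serves [defect_sqr_le], d^2 / 64 brings the defects into the Taylor range, and the
   last one makes the fourth order terms 32 g w^2 at most m w. *)
pose k := Num.min 1 (Num.min (d ^+ 2 / 64) (m / (32 * g + 1))).
exists k; first by rewrite !lt_min ltr01 k3 divr_gt0// exprn_gt0.
move=> a b; set w := a ^+ 2 + b ^+ 2 => /andP[w0 wk].
have w1 : w <= 1 by rewrite (le_trans wk)// ge_min lexx.
have wd : 64 * w <= d ^+ 2.
  by rewrite mulrC -ler_pdivlMr// (le_trans wk)// !ge_min lexx orbT.
have wg : w * (32 * g + 1) <= m.
  by rewrite -ler_pdivlMr ?(le_trans wk)// ?ge_min ?lexx ?orbT//; lra.
have term u x y : `|u| <= 1 -> x ^+ 2 + y ^+ 2 = w ->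
    `|(1 + defect u x y) `^ r -
       (1 + r * defect u x y + r * (r - 1) / 2 * defect u x y ^+ 2)| <= m / 8 * w.
  move=> u1 xy; have D2 := @defect_sqr_le u x y u1; rewrite xy in D2.
  have {}D2 := D2 w1.
  have /Hd : `|defect u x y| <= d.
    rewrite -(@ler_sqr _ `|_|) ?nnegrE// ?(ltW d0)// real_normK ?num_real//; lra.
  rewrite !opprD !addrA => H; apply: (le_trans H); nra.
pose q (u x y : R) : R := (1 + u) ^+ 2 * x ^+ 2 + (1 - u) ^+ 2 * y ^+ 2.
pose C (u : R) : R := q u a b ^+ 2 + q u b a ^+ 2 + (q u a b ^+ 2 + q u b a ^+ 2).
have C_bd u : `|u| <= 1 -> 0 <= C u <= 64 * w ^+ 2.
  move=> u1; have [u4 u4'] := sqr_le4 u1.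
  have qb x y : x ^+ 2 + y ^+ 2 = w -> 0 <= q u x y ^+ 2 <= 16 * w ^+ 2.
    move=> xy; rewrite sqr_ge0 /=.
    have -> : 16 * w ^+ 2 = (4 * w) ^+ 2 by ring.
    have x0 := sqr_ge0 x; have y0 := sqr_ge0 y.
    rewrite lerXn2r ?nnegrE//; first by rewrite addr_ge0// mulr_ge0 ?sqr_ge0.
      by rewrite mulr_ge0// ltW.
    by rewrite -xy /q mulrDr lerD// ler_wpM2r.
  have /andP[? ?] := qb a b erefl.
  have /andP[? ?] := qb b a (addrC _ _).
  by rewrite /C; apply/andP; split; lra.
have sumE u : `|u| <= 1 -> `|four_sum r u a b -
    (4 + 4 * r * (1 + u ^+ 2) * w + 4 * r * (r - 1) * (1 + u) ^+ 2 * w +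
     r * (r - 1) / 2 * C u)| <= m / 2 * w.
  move=> u1.
  have h1 := term u a b u1 erefl.
  have h2 : (- b) ^+ 2 + a ^+ 2 = w by rewrite sqrrN addrC.
  have h3 : (- a) ^+ 2 + (- b) ^+ 2 = w by rewrite !sqrrN.
  have h4 : b ^+ 2 + (- a) ^+ 2 = w by rewrite sqrrN addrC.
  have {}h2 := term u _ _ u1 h2.
  have {}h3 := term u _ _ u1 h3.
  have {}h4 := term u _ _ u1 h4.
  have := le_trans (ler_normD _ _) (lerD (le_trans (ler_normD _ _) (lerD h1 h2))
    (le_trans (ler_normD _ _) (lerD h3 h4))).
  rewrite (_ : m / 8 * w + _ + _ = m / 2 * w); last by field.
  move=> H; apply: le_trans H; rewrite le_eqVlt; apply/orP; left; apply/eqP.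
  by congr (`|_|); rewrite /four_sum /C /q /defect /w; field.
have S1 := sumE t t1; have S0 := sumE 0 t10.
have /andP[Ct0 Ct] := C_bd t t1; have /andP[C00 C0] := C_bd 0 t10.
have main : (4 * r * (1 + t ^+ 2) * w + 4 * r * (r - 1) * (1 + t) ^+ 2 * w) -
    (4 * r * (1 + 0 ^+ 2) * w + 4 * r * (r - 1) * (1 + 0) ^+ 2 * w) = - (4 * m * w).
  rewrite (_ : _ - _ = 4 * w * ((r * t) ^+ 2 + 2 * (r - 1) * (r * t))); last by ring.
  by rewrite rt /m; ring.
have CC : r * (r - 1) / 2 * (C t - C 0) <= 32 * g * w * w.
  rewrite (le_trans (ler_norm _))// normrM.
  have -> : `|r * (r - 1) / 2| = g / 2 by rewrite normrM normfV (@ger0_norm _ 2).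
  have : `|C t - C 0| <= 64 * w ^+ 2 by rewrite ler_norml; apply/andP; split; lra.
  by rewrite expr2 => H; have := ler_wpM2l g0 H; lra.
have wgw : w * (32 * g + 1) * w <= m * w by rewrite ler_pM2r.
have mw : 0 < m * w by rewrite mulr_gt0.
have ww : 0 <= w * w by rewrite mulr_ge0 ?ltW.
move: S1 S0; rewrite !ler_norml => /andP[_ S1] /andP[S0 _].
move: S1 S0 main CC; rewrite mulrBr; lra.
Qed.

End FourPoints.

(** * Orthogonal elements have ranges with disjoint supports *)

Lemma powR_mean2 {R : realType} (p x y : R) : 1 <= p -> 0 <= x -> 0 <= y ->
  ((x + y) / 2) `^ p <= (x `^ p + y `^ p) / 2.
Proof.
move=> p1 x0 y0; rewrite !mulrDl ![_ / 2]mulrC.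
have h01 : 0 <= (2^-1 : R) <= 1 by rewrite invr_ge0 ler0n invf_le1 ?ler1n.
have hE : 1 - 2^-1 = 2^-1 :> R by lra.
have [h0 h1] := andP h01.
have := convex_powR p1 (Itv01 h0 h1) (x := x) (y := y).
rewrite !inE/= !in_itv/= x0 y0 => /(_ isT isT).
by rewrite convRE [X in X `^ _ <= _ -> _]convRE /= /unstable.onem hE.
Qed.

Lemma powR_mean4 {R : realType} (p n x1 x2 x3 x4 : R) : 1 <= p -> 0 <= n ->
  0 <= x1 -> 0 <= x2 -> 0 <= x3 -> 0 <= x4 -> 4 * n <= x1 + x2 + (x3 + x4) ->
  4 * n `^ p <= x1 `^ p + x2 `^ p + (x3 `^ p + x4 `^ p).
Proof.
move=> p1 n0 h1 h2 h3 h4 H.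
have m1 := powR_mean2 p1 h1 h2; have m2 := powR_mean2 p1 h3 h4.
have u0 : 0 <= (x1 + x2) / 2 by lra.
have v0 : 0 <= (x3 + x4) / 2 by lra.
have m3 := powR_mean2 p1 u0 v0.
have : n `^ p <= (((x1 + x2) / 2 + (x3 + x4) / 2) / 2) `^ p.
  by rewrite ge0_ler_powR ?nnegrE//; lra.
lra.
Qed.

Definition twist (R : realType) (T : Type) (f g : T -> R[i]) (z : R[i])
  (h : T -> R[i]) (x : T) : R[i] := f x + z * g x + z^-1 * h x.

Section IsometricRep.
Context {R : realType} {d : measure_display} {T : measurableType d}
  (mu : {measure set T -> \bar R}) (p : R) (p1 : 1 <= p).
Implicit Types f g h : T -> R[i].

Local Notation Lp := (cLp mu p).

(** [fine] sends an infinite norm to 0, so the value is the norm only for functions in [Lp]. *)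
Definition lpn f : R := fine (cLpnorm mu p f).

Let p0 : 0 < p. Proof. exact: lt_le_trans p1. Qed.

Lemma lpnE f : Lp f -> cLpnorm mu p f = (lpn f)%:E.
Proof.
by case=> _ _ ?; rewrite fineK// ge0_fin_numE ?cLpnorm_ge0.
Qed.

Lemma lpn_ge0 f : 0 <= lpn f.
Proof. exact/fine_ge0/cLpnorm_ge0. Qed.

Lemma lpnD f g : Lp f -> Lp g -> lpn (fun x => f x + g x) <= lpn f + lpn g.
Proof.
move=> Lf Lg; have Lfg := cLpD p1 Lf Lg; rewrite -lee_fin EFinD -!lpnE//.
by apply: cLpnormD => //; exact: (@cLp_measurable _ _ _ mu p).
Qed.

Lemma lpnZ (k : R[i]) f : Lp f -> lpn (fun x => k * f x) = cmod k * lpn f.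
Proof.
move=> Lf; have Lkf := cLpZ p1 k Lf; apply: EFin_inj; rewrite EFinM -!lpnE//.
exact: cLpnormZ.
Qed.

Lemma lpn_ae f g : Lp f -> Lp g -> {ae mu, forall x, f x = g x} ->
  lpn f = lpn g.
Proof.
by move=> Lf Lg fg; congr fine; apply: cLpnorm_ae => //; exact: (@cLp_measurable _ _ _ mu p).
Qed.

Lemma cLpB f g : Lp f -> Lp g -> Lp (fun x => f x - g x).
Proof.
move=> Lf Lg; rewrite (_ : (fun _ => _) = (fun x => f x + -1 * g x)).
  by apply: cLpD => //; exact: cLpZ.
by apply/funext => x; rewrite mulN1r.
Qed.

Lemma lpn_distC f g : Lp f -> Lp g ->
  lpn (fun x => f x - g x) = lpn (fun x => g x - f x).
Proof.
move=> Lf Lg; rewrite (_ : (fun x => f x - _) = (fun x => -1 * (g x - f x))).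
  by rewrite lpnZ ?cmodN ?cmod1 ?mul1r//; exact: cLpB.
by apply/funext => x; rewrite mulN1r opprB.
Qed.

Lemma lpn_powR f : Lp f ->
  (lpn f `^ p)%:E = (\int[mu]_x (cmod (f x) `^ p)%:E)%E.
Proof. by move=> Lf; rewrite -poweR_EFin -lpnE// cLpnorm_powR. Qed.

Context {A : lmodType R[i]} (mul : A -> A -> A) (star : A -> A) (nrm : A -> R).
Context (HA : is_cstar_algebra mul star nrm).
Context (pi : A -> (T -> R[i]) -> (T -> R[i])).
Context (Hpi : isometric_Lp_rep mu p mul nrm pi).

Lemma rep_Lp a f : Lp f -> Lp (pi a f).
Proof. by case: Hpi => /(_ a)[+ _ _ _] _ _ _; exact. Qed.

Lemma rep_ae a f g : Lp f -> Lp g -> {ae mu, forall x, f x = g x} ->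
  {ae mu, forall x, pi a f x = pi a g x}.
Proof. by case: Hpi => /(_ a)[_ + _ _] _ _ _; exact. Qed.

Lemma rep_lin a (k : R[i]) f g : Lp f -> Lp g ->
  {ae mu, forall x, pi a (fun y => k * f y + g y) x = k * pi a f x + pi a g x}.
Proof. by case: Hpi => /(_ a)[_ _ + _] _ _ _; exact. Qed.

Lemma rep_comb (k : R[i]) a b f : Lp f ->
  {ae mu, forall x, pi (k *: a + b) f x = k * pi a f x + pi b f x}.
Proof. by case: Hpi => _ + _ _; exact. Qed.

Lemma rep_mul a b f : Lp f ->
  {ae mu, forall x, pi (mul a b) f x = pi a (pi b f) x}.
Proof. by case: Hpi => _ _ + _; exact. Qed.

Lemma rep_fun0 a : {ae mu, forall x, pi a (fun=> 0) x = 0}.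
Proof.
have := rep_lin a (-1) (cLp0 mu p1) (cLp0 mu p1); apply: filterS => x.
rewrite (_ : (fun y => -1 * 0 + 0) = (fun=> 0)); first by rewrite mulN1r addNr.
by apply/funext => y; rewrite mulr0 addr0.
Qed.

Lemma rep_scale a (k : R[i]) f : Lp f ->
  {ae mu, forall x, pi a (fun y => k * f y) x = k * pi a f x}.
Proof.
move=> Lf; have := rep_lin a k Lf (cLp0 mu p1); have := rep_fun0 a.
apply: filterS2 => x ->; rewrite addr0 => <-; congr (pi a _ x).
by apply/funext => y; rewrite addr0.
Qed.

Lemma rep_zero f : Lp f -> {ae mu, forall x, pi 0 f x = 0}.
Proof.
move=> Lf; have := rep_comb (-1) 0 0 Lf; apply: filterS => x.
by rewrite scaler0 addr0 mulN1r addNr.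
Qed.

Lemma rep_contraction a f : Lp f -> lpn (pi a f) <= nrm a * lpn f.
Proof.
move=> Lf; have Lpf := rep_Lp a Lf.
(* A null f cannot be normalized for the supremum in the operator norm; there the bound M applies
   instead. *)
have [f0|f0] := eqVneq (lpn f) 0.
  case: Hpi => /(_ a)[_ _ _ [M HM]] _ _ _; have := HM f Lf.
  by rewrite !lpnE// -EFinM lee_fin f0 !mulr0.
have {}f0 : 0 < lpn f by rewrite lt_def f0 lpn_ge0.
pose k := (lpn f)^-1%:C%C; pose g x := k * f x.
have Lg : Lp g by exact: cLpZ.
have ck : cmod k = (lpn f)^-1 by rewrite cmod_real ger0_norm// invr_ge0 ltW.
have g1 : lpn g = 1 by rewrite lpnZ// ck mulVf// gt_eqF.
have : ((lpn (pi a g))%:E <= (nrm a)%:E)%E.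
  case: Hpi => _ _ _ <-; rewrite -lpnE; last exact: rep_Lp.
  by apply: ereal_sup_ubound; exists g => //; split => //; rewrite lpnE// g1.
rewrite lee_fin (@lpn_ae _ (fun x => k * pi a f x)); last 3 first.
- exact: rep_Lp.
- exact: cLpZ.
- exact: rep_scale.
by rewrite lpnZ// ck ler_pdivrMl// mulrC.
Qed.

Lemma rep_approx e a xi : Lp xi ->
  lpn (fun x => pi e (pi a xi) x - pi a xi x) <= nrm (mul e a - a) * lpn xi.
Proof.
move=> Lxi; have Lf := rep_Lp a Lxi.
apply: le_trans (rep_contraction (mul e a - a) Lxi).
rewrite (@lpn_ae (fun x => pi e (pi a xi) x - pi a xi x) (pi (mul e a - a) xi))//.
- by apply: cLpB => //; exact: rep_Lp.
- exact: rep_Lp.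
- apply: filterS2 (rep_mul e a Lxi) (rep_comb (-1) a (mul e a) Lxi) => x E1.
  by rewrite scaleN1r addrC E1 => ->; rewrite mulN1r addrC.
Qed.

Let star_mul_eq0 a b : star a = a -> star b = b -> mul a b = 0 -> mul b a = 0.
Proof.
case: HA => _ [_ [_ [_ [[_ starZ _ starM] _]]]] sa sb ab.
rewrite -sa -sb -starM ab -(scale0r (0 : A)) starZ.
by rewrite conjc0 !scale0r.
Qed.

(** With approximate units u1 of a and u2 of b, the contraction u1 + w u2 is applied to pi a xi + z
    pi b eta + k h. Since u1 b = 0 and u2 a = 0, the cross terms vanish, and F, G, H1, H2 are the
    remaining images. *)
Lemma approx_orthogonal_split a b xi eta h (e : R) : star a = a -> star b = b ->
  mul a b = 0 -> Lp xi -> Lp eta -> Lp h -> 0 < e ->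
  exists F G H1 H2, [/\ [/\ Lp F, Lp G, Lp H1 & Lp H2],
    lpn (fun x => F x - pi a xi x) <= e, lpn (fun x => G x - pi b eta x) <= e &
    forall z k w, cmod w = 1 ->
      lpn (fun x => F x + w * z * G x + k * H1 x + k * w * H2 x) <=
      lpn (fun x => pi a xi x + z * pi b eta x + k * h x)].
Proof.
move=> sa sb ab Lxi Leta Lh e0.
have ba := star_mul_eq0 sa sb ab.
pose c := lpn xi + lpn eta + 1.
have c0 : 0 < c by rewrite ltr_wpDl ?addr_ge0 ?lpn_ge0.
have ec0 : 0 < e / c by rewrite divr_gt0.
have ecE : e / c * c = e by rewrite divfK// gt_eqF.
have [u1 [su1 n1 a1 z1]] := approx_unit HA sa ec0.
have [u2 [su2 n2 b2 z2]] := approx_unit HA sb ec0.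
have u12 : mul u1 u2 = 0.
  by apply: z1; apply: star_mul_eq0 => //; exact: z2.
have Lf := rep_Lp a Lxi; have Lg := rep_Lp b Leta.
exists (pi u1 (pi a xi)), (pi u2 (pi b eta)), (pi u1 h), (pi u2 h).
have x0 := lpn_ge0 xi; have y0 := lpn_ge0 eta.
split.
- by split; exact: rep_Lp.
- apply: (le_trans (rep_approx _ _ Lxi)); rewrite -ecE ler_pM ?(cstar_nrm_ge0 HA)//.
  by rewrite /c; lra.
- apply: (le_trans (rep_approx _ _ Leta)); rewrite -ecE ler_pM ?(cstar_nrm_ge0 HA)//.
  by rewrite /c; lra.
move=> z k w w1.
pose v x := z * pi b eta x + pi a xi x; pose u x := k * h x + v x.
have Lv : Lp v by apply: cLpD => //; exact: cLpZ.
have Lu : Lp u by apply: cLpD => //; exact: cLpZ.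
rewrite (_ : (fun x => pi a xi x + _ + _) = u); last first.
  by apply/funext => x; rewrite /u /v; ring.
have V1 := orthogonal_contraction HA su1 su2 u12 n1 n2 w1.
apply: (@le_trans _ _ (lpn (pi (u1 + w *: u2) u))); last first.
  apply: (le_trans (rep_contraction _ Lu)).
  by rewrite -[leRHS]mul1r ler_wpM2r ?lpn_ge0.
rewrite (@lpn_ae _ (pi (u1 + w *: u2) u))//.
- apply: cLpD; [exact: p1| |by apply: cLpZ => //; exact: rep_Lp].
  apply: cLpD; [exact: p1| |by apply: cLpZ => //; exact: rep_Lp].
  by apply: cLpD; [exact: p1| |apply: cLpZ => //]; exact: rep_Lp.
- exact: rep_Lp.
- have kill c1 c2 om : Lp om -> mul c1 c2 = 0 ->
      {ae mu, forall x, pi c1 (pi c2 om) x = 0}.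
    move=> Lom c12; apply: filterS2 (rep_zero Lom) (rep_mul c1 c2 Lom) => x E1 E2.
    by rewrite -E2 c12.
  have K1 := kill _ _ _ Leta (z1 _ ab); have K2 := kill _ _ _ Lxi (z2 _ ba).
  have C1 : {ae mu, forall x, pi u1 v x = pi u1 (pi a xi) x}.
    apply: filterS2 (rep_lin u1 z Lg Lf) K1 => x E1 E2.
    by rewrite E1 E2 mulr0 add0r.
  have C2 : {ae mu, forall x, pi u2 v x = z * pi u2 (pi b eta) x}.
    apply: filterS2 (rep_lin u2 z Lg Lf) K2 => x E1 E2.
    by rewrite E1 E2 addr0.
  have D1 : {ae mu, forall x, pi u1 u x = k * pi u1 h x + pi u1 (pi a xi) x}.
    by apply: filterS2 (rep_lin u1 k Lh Lv) C1 => x E1 E2; rewrite E1 E2.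
  have D2 : {ae mu, forall x, pi u2 u x = k * pi u2 h x + z * pi u2 (pi b eta) x}.
    by apply: filterS2 (rep_lin u2 k Lh Lv) C2 => x E1 E2; rewrite E1 E2.
  apply: filterS3 (rep_comb w u2 u1 Lu) D1 D2 => x E1 E2 E3.
  by rewrite [u1 + _]addrC E1 E2 E3; ring.
Qed.

Section Orthogonal.
Context (a b : A) (sa : star a = a) (sb : star b = b) (ab : mul a b = 0).
Context (xi eta : T -> R[i]) (Lxi : Lp xi) (Leta : Lp eta).

Let f := pi a xi.
Let g := pi b eta.
Let Lf : Lp f. Proof. exact: rep_Lp. Qed.
Let Lg : Lp g. Proof. exact: rep_Lp. Qed.

Local Notation tw := (twist f g).

Let i_unit : cmod ('i%C : R[i]) = 1.
Proof. by rewrite /cmod /= expr0n expr1n add0r sqrtr1. Qed.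

Let invi : ('i%C)^-1 = - 'i%C :> R[i].
Proof.
have i0 : 'i%C != 0 :> R[i] by rewrite eq_complex /= oner_eq0 andbF.
by apply: (mulfI i0); rewrite mulfV// mulrN -expr2 sqr_i opprK.
Qed.

(* The four contractions move [f + z g + h / z] close to
   [f + g + H1 / z + H2 / z^2]; both [1 / z] and [1 / z^2] sum to 0 over
   [z^4 = 1], leaving [4 (f + g)]. *)
Lemma four_twists_ge h : Lp h ->
  4 * lpn (fun x => f x + g x) <=
  lpn (tw 1 h) + lpn (tw (-1) h) + (lpn (tw 'i%C h) + lpn (tw (- 'i%C) h)).
Proof.
move=> Lh; apply/ler_addgt0Pr => e e0.
have e8 : 0 < e / 8 by rewrite divr_gt0.
have [F [G [H1 [H2 [[LF LG LH1 LH2] HF HG HV]]]]] :=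
  approx_orthogonal_split sa sb ab Lxi Leta Lh e8.
pose V z x := F x + z^-1 * z * G x + z^-1 * H1 x + z^-1 * z^-1 * H2 x.
have VN z : cmod z = 1 -> lpn (V z) <= lpn (tw z h).
  by move=> z1; apply: HV; rewrite cmodV z1 invr1.
have LV z : Lp (V z).
  apply: cLpD; [exact: p1| |exact: cLpZ].
  apply: cLpD; [exact: p1| |exact: cLpZ].
  by apply: cLpD; [exact: p1|exact: LF|exact: cLpZ].
have n1 : cmod (-1 : R[i]) = 1 by rewrite cmodN cmod1.
have ni : cmod (- 'i%C : R[i]) = 1 by rewrite cmodN i_unit.
have := VN 1 cmod1; have := VN _ n1; have := VN _ i_unit; have := VN _ ni.
pose B x := F x + G x.
have LB : Lp B by exact: cLpD.
have B4 : 4 * lpn B <= lpn (V 1) + lpn (V (-1)) + (lpn (V 'i%C) + lpn (V (- 'i%C))).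
  have <- : cmod (4%:R : R[i]) = 4.
    by rewrite -(rmorph_nat (@real_complex R)) cmod_real ger0_norm.
  rewrite -lpnZ// (_ : (fun x => _) = (fun x => (V 1 x + V (-1) x) +
     (V 'i%C x + V (- 'i%C) x))).
    have L1 : Lp (fun x => V 1 x + V (-1) x) by exact: cLpD.
    have L2 : Lp (fun x => V 'i%C x + V (- 'i%C) x) by exact: cLpD.
    exact: le_trans (lpnD L1 L2) (lerD (lpnD (LV _) (LV _)) (lpnD (LV _) (LV _))).
  apply/funext => x; rewrite /V /B invr1 invrN invr1 invrN invi.
  have ii : 'i%C * 'i%C = -1 :> R[i] by rewrite -expr2 sqr_i.
  rewrite !(mulrN, mulNr, opprK, mul1r, mulr1) ii !(mulN1r, opprK, mul1r).
  ring.
have fg : lpn (fun x => f x + g x) <= lpn B + (e / 8 + e / 8).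
  rewrite (_ : (fun x => f x + g x) = (fun x => B x + ((f x - F x) + (g x - G x)))).
    rewrite (le_trans (lpnD _ _))//; first by apply: cLpD => //; exact: cLpB.
    rewrite lerD2l (le_trans (lpnD _ _))//; [exact: cLpB|exact: cLpB|].
    by rewrite lerD// lpn_distC.
  by apply/funext => x; rewrite /B; ring.
lra.
Qed.

(** The contraction u1 + z u2 carries f + g close to f + z g. *)
Lemma twist0_le z : cmod z = 1 -> lpn (tw z (fun=> 0)) <= lpn (fun x => f x + g x).
Proof.
move=> z1; apply/ler_addgt0Pr => e e0.
have e2 : 0 < e / 2 by rewrite divr_gt0.
have [F [G [H1 [H2 [[LF LG LH1 LH2] HF HG HV]]]]] :=
  approx_orthogonal_split sa sb ab Lxi Leta (cLp0 mu p1) e2.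
have LGz : Lp (fun x => z * G x) by exact: cLpZ.
have := HV 1 0 z z1.
rewrite (_ : (fun x => F x + _ + _ + _) = (fun x => F x + z * G x)); last first.
  by apply/funext => x; ring.
rewrite (_ : (fun x => pi a xi x + _ + _) = (fun x => f x + g x)); last first.
  by apply/funext => x; rewrite /f /g; ring.
move=> H.
rewrite (_ : tw _ _ = (fun x => (F x + z * G x) +
    ((f x - F x) + z * (g x - G x)))); last first.
  by apply/funext => x; rewrite /twist; ring.
rewrite (le_trans (lpnD _ _))//; [exact: cLpD| |].
  by apply: cLpD; [exact: p1|exact: cLpB|apply: cLpZ => //; exact: cLpB].
rewrite lerD// (le_trans (lpnD _ _))//; [exact: cLpB|by apply: cLpZ => //; exact: cLpB|].
rewrite lpnZ; last exact: cLpB.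
rewrite z1 mul1r lpn_distC// [X in _ + X]lpn_distC//.
by rewrite [e]splitr lerD.
Qed.

(** At h = 0 all four norms are at most that of f + g, which [four_twists_ge] bounds by the mean of
    the norms at h. Convexity of the p-th power passes to integrals, which can be compared
    pointwise. *)
Lemma four_twists_powR h : Lp h ->
  lpn (tw 1 (fun=> 0)) `^ p + lpn (tw (-1) (fun=> 0)) `^ p +
    (lpn (tw 'i%C (fun=> 0)) `^ p + lpn (tw (- 'i%C) (fun=> 0)) `^ p) <=
  lpn (tw 1 h) `^ p + lpn (tw (-1) h) `^ p +
    (lpn (tw 'i%C h) `^ p + lpn (tw (- 'i%C) h) `^ p).
Proof.
move=> Lh; have n0 := lpn_ge0 (fun x => f x + g x).
have mean := powR_mean4 p1 n0 (lpn_ge0 (tw 1 h)) (lpn_ge0 (tw (-1) h))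
  (lpn_ge0 (tw 'i%C h)) (lpn_ge0 (tw (- 'i%C) h)) (four_twists_ge Lh).
have le z : cmod z = 1 ->
    lpn (tw z (fun=> 0)) `^ p <= lpn (fun x => f x + g x) `^ p.
  by move=> z1; rewrite ge0_ler_powR ?(ltW p0)// ?nnegrE ?lpn_ge0// twist0_le.
have n1 : cmod (-1 : R[i]) = 1 by rewrite cmodN cmod1.
have ni : cmod (- 'i%C : R[i]) = 1 by rewrite cmodN i_unit.
move: (le 1 cmod1) (le _ n1) (le _ i_unit) (le _ ni) => h1 h2 h3 h4.
have q4 (q : R) : q + q + (q + q) <= 4 * q by lra.
exact: le_trans (lerD (lerD h1 h2) (lerD h3 h4)) (le_trans (q4 _) mean).
Qed.

End Orthogonal.

End IsometricRep.

(** * Pointwise decrease under the perturbation *)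

Section Pointwise.
Context {R : realType}.
Implicit Types u v h z : R[i].

(** The factors 1 and the inverses are left unsimplified so that each term is [twist] by mere
    unfolding. *)
Definition four_moduli (p : R) u v h : R :=
  cmod (u + 1 * v + 1^-1 * h) `^ p + cmod (u + -1 * v + (-1)^-1 * h) `^ p +
  (cmod (u + 'i%C * v + ('i%C)^-1 * h) `^ p +
   cmod (u + - 'i%C * v + (- 'i%C)^-1 * h) `^ p).

(* Away from [u = 0] this is [s * u * conj (v / u)]. *)
Definition perturbation (s : R) u v : R[i] :=
  (s * (cmod u ^+ 2) `^ (-1))%:C%C * (u * (u * (v^*)%C)).

Lemma cmod_perturbation s u v : cmod (perturbation s u v) <= `|s| * cmod v.
Proof.
rewrite /perturbation !cmodM cmod_real cmod_conj normrM.
rewrite [`|_ `^ _|]ger0_norm ?powR_ge0// -mulrA ler_wpM2l//.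
have [->|u0] := eqVneq (cmod u) 0; first by rewrite !mul0r mulr0 cmod_ge0.
rewrite powR_inv1 ?sqr_ge0// !mulrA -[_ * cmod u * cmod u]mulrA -expr2.
by rewrite mulVf ?mul1r// sqrf_eq0.
Qed.

Lemma cmod_powR_defect (p s : R) z :
  cmod (1 + z + s%:C%C * (z^*)%C) `^ p =
  (1 + defect s (complex.Re z) (complex.Im z)) `^ (p / 2).
Proof.
rewrite -(mulrC 2^-1) -[in LHS](mulVKf (_ : 2 != 0 :> R) p)//.
rewrite powRrM -[2]/(2%:R) powR_mulrn ?cmod_ge0// cmod_sqr; congr (_ `^ _).
by case: z => x y /=; rewrite /defect; ring.
Qed.

(** Put w = v / u. For a fourth root of unity z the inverse is the conjugate, so each term is |u|^p
    |1 + z w + s conj (z w)|^p, and [four_sum_lt] applies with r = p / 2. *)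
Lemma four_moduli_lt (p : R) : 1 <= p -> p != 2 -> exists2 k, 0 < k &
  exists s, forall u v, 0 < cmod v ^+ 2 <= k * cmod u ^+ 2 ->
    four_moduli p u v (perturbation s u v) < four_moduli p u v 0.
Proof.
move=> p1 p2; have r2 : 2^-1 <= p / 2 by lra.
have r1 : p / 2 != 1 by apply: contra_neq p2 => H; lra.
have [k k0 Hk] := four_sum_lt r2 r1.
exists k => //; exists ((1 - p / 2) / (p / 2)); move: (_ / (p / 2)) Hk => s Hk.
move=> u v /andP[v0 vk].
have u0 : u != 0.
  by apply: contraTneq vk => ->; rewrite cmod0 expr0n /= mulr0 -ltNge.
have cu0 : 0 < cmod u.
  by rewrite lt_def cmod_ge0 andbT; apply: contra_neq u0 => /cmod_eq0.
have cu2 : 0 < cmod u ^+ 2 by rewrite exprn_gt0.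
pose w := v / u.
have vE : v = u * w by rewrite mulrC divfK.
have cw : cmod w ^+ 2 = cmod v ^+ 2 / cmod u ^+ 2.
  by rewrite cmodM cmodV exprMn exprVn.
have hE : perturbation s u v = u * (s%:C%C * (w^*)%C).
  rewrite /perturbation powR_inv1 ?ltW// vE.
  have uu : u * (u^*)%C = (cmod u ^+ 2)%:C%C.
    rewrite cmod_sqr; case: (u) => x y; apply/eqP; rewrite eq_complex /=.
    by apply/andP; split; apply/eqP; ring.
  have C0 : (cmod u ^+ 2)%:C%C != 0 :> R[i] by rewrite fmorph_eq0 gt_eqF.
  have -> : ((u * w)^*)%C = (u^*)%C * (w^*)%C by exact: (rmorphM (@conjc R)).
  rewrite (rmorphM (@real_complex R)) (fmorphV (@real_complex R)).
  move: uu; move: (u^*)%C (w^*)%C => u' w' uu.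
  transitivity (s%:C%C / (cmod u ^+ 2)%:C%C * (u * u') * (u * w')); first by ring.
  by rewrite uu divfK//; ring.
have term z : z^-1 = (z^*)%C -> cmod (u + z * v + z^-1 * perturbation s u v) `^ p =
    cmod u `^ p * (1 + defect s (complex.Re (z * w)) (complex.Im (z * w))) `^ (p / 2).
  move=> zV; rewrite -cmod_powR_defect -powRM ?cmod_ge0// -cmodM; congr (cmod _ `^ _).
  rewrite hE zV vE (_ : ((z * w)^*)%C = (z^*)%C * (w^*)%C); first by ring.
  exact: (rmorphM (@conjc R)).
have term0 z : cmod (u + z * v + z^-1 * 0) `^ p =
    cmod u `^ p * (1 + defect 0 (complex.Re (z * w)) (complex.Im (z * w))) `^ (p / 2).
  rewrite -cmod_powR_defect -powRM ?cmod_ge0// -cmodM; congr (cmod _ `^ _).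
  by rewrite vE rmorph0; ring.
have V1 : (1 : R[i])^-1 = (1^*)%C by rewrite invr1 conjc1.
have VN1 : (-1 : R[i])^-1 = ((-1)^*)%C by rewrite invrN invr1 rmorphN1.
have i0 : 'i%C != 0 :> R[i] by rewrite eq_complex /= oner_eq0 andbF.
have Vi : ('i%C : R[i])^-1 = ('i^*)%C.
  apply: (mulfI i0); rewrite mulfV//; apply/eqP; rewrite eq_complex /=.
  by apply/andP; split; apply/eqP; ring.
have VNi : (- 'i%C : R[i])^-1 = ((- 'i)^*)%C by rewrite invrN Vi rmorphN.
rewrite /four_moduli !term// !term0.
have := Hk (complex.Re w) (complex.Im w); rewrite -cmod_sqr cw.
rewrite divr_gt0//= ler_pdivrMr// vk => /(_ isT); rewrite /four_sum.
have cp : 0 < cmod u `^ p by rewrite powR_gt0.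
rewrite -!mulrDr ltr_pM2l//.
case: (w) => x y /=.
rewrite !mul0r !mul1r !mulN1r ?oppr0 ?sub0r ?add0r ?addr0 ?subr0.
rewrite ?mulNr ?mul0r ?mul1r ?opprK ?oppr0 ?sub0r ?add0r ?addr0 ?subr0.
lra.
Qed.

End Pointwise.

(** * From integrals to disjoint supports *)

Section IntegralComparison.
Context {R : realType} {d : measure_display} {T : measurableType d}
  (mu : {measure set T -> \bar R}).

Lemma ae_eq_integral_ge (F G : T -> R) :
  measurable_fun setT F -> measurable_fun setT G -> (forall x, 0 <= G x <= F x) ->
  (\int[mu]_x (F x)%:E <= \int[mu]_x (G x)%:E)%E -> (\int[mu]_x (F x)%:E < +oo)%E ->
  {ae mu, forall x, F x = G x}.
Proof.
move=> mF mG GF FG Ffin.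
have D0 x : 0 <= F x - G x by rewrite subr_ge0; case/andP: (GF x).
have G0 x : 0 <= G x by case/andP: (GF x).
have mD : measurable_fun setT (fun x => (F x - G x)%:E).
  by apply/measurable_EFinP; exact: measurable_funB.
have E : (\int[mu]_x (F x)%:E = \int[mu]_x (G x)%:E + \int[mu]_x (F x - G x)%:E)%E.
  rewrite -ge0_integralD//.
  - by apply: eq_integral => x _; rewrite -EFinD addrC subrK.
  - by move=> x _; rewrite lee_fin.
  - exact/measurable_EFinP.
  - by move=> x _; rewrite lee_fin.
have I0 : (\int[mu]_x (F x - G x)%:E = 0)%E.
  apply/eqP; rewrite eq_le integral_ge0 ?andbT; last by move=> x _; rewrite lee_fin.
  have Gfin : (\int[mu]_x (G x)%:E \is a fin_num)%E.
    rewrite ge0_fin_numE; last by apply: integral_ge0 => x _; rewrite lee_fin.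
    apply: le_lt_trans Ffin; rewrite E leeDl//.
    by apply: integral_ge0 => x _; rewrite lee_fin.
  by move: FG; rewrite E -[leRHS]adde0 leeD2lE.
have : ae_eq mu setT (fun x => (F x - G x)%:E) (cst 0%E).
  apply/ae_eq_integral_abs => //; rewrite -[RHS]I0; apply: eq_integral => x _.
  by rewrite gee0_abs// lee_fin.
by apply: filterS => x /(_ I) /eqP; rewrite eqe subr_eq0 => /eqP.
Qed.

End IntegralComparison.

Section Disjointness.
Context {R : realType} {d : measure_display} {T : measurableType d}
  (mu : {measure set T -> \bar R}) (p : R) (p1 : 1 <= p).

Local Notation Lp := (cLp mu p).
Local Notation lpn := (lpn mu p).

Lemma lpn_four_twists f g h : Lp f -> Lp g -> Lp h ->
  (lpn (twist f g 1 h) `^ p + lpn (twist f g (-1) h) `^ p +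
    (lpn (twist f g 'i%C h) `^ p + lpn (twist f g (- 'i%C) h) `^ p))%:E =
  (\int[mu]_x (four_moduli p (f x) (g x) (h x))%:E)%E.
Proof.
move=> Lf Lg Lh.
have Lt z : Lp (twist f g z h).
  by apply: cLpD; [exact: p1|apply: cLpD; [exact: p1|exact: Lf|exact: cLpZ]|exact: cLpZ].
have mt z : measurable_fun setT (fun x => (cmod (twist f g z h x) `^ p)%:E).
  apply/measurable_EFinP; apply: (measurableT_comp (measurable_powR p)).
  by apply: measurable_cmod; exact: (@cLp_measurable _ _ _ mu p).
have t0 z x : setT x -> (0 <= (cmod (twist f g z h x) `^ p)%:E)%E.
  by move=> _; rewrite lee_fin powR_ge0.
have E (a b c e : R) : ((a + b + (c + e))%:E = (a%:E + b%:E) + (c%:E + e%:E))%E by [].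
pose w z x := (cmod (twist f g z h x) `^ p)%:E.
have Lw z : (lpn (twist f g z h) `^ p)%:E = (\int[mu]_x w z x)%E.
  exact: (lpn_powR p1 (Lt z)).
have Dw z z' : ((lpn (twist f g z h) `^ p)%:E + (lpn (twist f g z' h) `^ p)%:E =
    \int[mu]_x (w z x + w z' x))%E.
  by rewrite (ge0_integralD mu measurableT (t0 z) (mt z) (t0 z') (mt z'));
    congr (_ + _)%E; exact: Lw.
have tt z z' x : setT x -> (0 <= w z x + w z' x)%E.
  by move=> X; apply: adde_ge0; exact: t0.
transitivity (\int[mu]_x (w 1%R x + w (-1)%R x) +
    \int[mu]_x (w 'i%C x + w (- 'i%C)%R x))%E.
  by apply: etrans (E _ _ _ _) _; congr (_ + _)%E; exact: Dw.
apply: etrans (esym (ge0_integralD mu measurableT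
  (tt 1 (-1)) (emeasurable_funD (mt 1) (mt (-1)))
  (tt 'i%C (- 'i%C)) (emeasurable_funD (mt 'i%C) (mt (- 'i%C))))) _.
by apply: eq_integral => x _; exact: esym (E _ _ _ _).
Qed.

(** Let h be the perturbation on the offending set and 0 elsewhere. The integrand drops strictly on
    that set and nowhere grows, while the integral does not drop, so the set is null. *)
Lemma ae_of_four_twists f g k s : Lp f -> Lp g ->
  (forall u v : R[i], 0 < cmod v ^+ 2 <= k * cmod u ^+ 2 ->
    four_moduli p u v (perturbation s u v) < four_moduli p u v 0) ->
  (forall h, Lp h ->
    lpn (twist f g 1 (fun=> 0)) `^ p + lpn (twist f g (-1) (fun=> 0)) `^ p +
      (lpn (twist f g 'i%C (fun=> 0)) `^ p + lpn (twist f g (- 'i%C) (fun=> 0)) `^ p) <=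
    lpn (twist f g 1 h) `^ p + lpn (twist f g (-1) h) `^ p +
      (lpn (twist f g 'i%C h) `^ p + lpn (twist f g (- 'i%C) h) `^ p)) ->
  {ae mu, forall x, ~~ (0 < cmod (g x) ^+ 2 <= k * cmod (f x) ^+ 2)}.
Proof.
move=> Lf Lg Hlt Hle.
have mf := cLp_measurable Lf; have mg := cLp_measurable Lg.
have mf2 : measurable_fun setT (fun x => cmod (f x) ^+ 2).
  exact/measurable_funX/measurable_cmod.
have mg2 : measurable_fun setT (fun x => cmod (g x) ^+ 2).
  exact/measurable_funX/measurable_cmod.
pose B x := (0 < cmod (g x) ^+ 2) && (cmod (g x) ^+ 2 <= k * cmod (f x) ^+ 2).
have mB : measurable_fun setT B.
  apply: measurable_and; first exact: measurable_fun_ltr.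
  by apply: measurable_fun_ler => //; exact: measurable_funM.
pose q x := perturbation s (f x) (g x).
have mq : cmeasurable q.
  apply: cmeasurableM; last first.
    apply: cmeasurableM => //; apply: cmeasurableM => //; exact: cmeasurable_conj.
  apply: cmeasurable_real; apply: measurable_funM => //.
  (* The inverse in [perturbation] is written as a real power, so its measurability needs no case
     split at the zeros of f. *)
  exact: (measurableT_comp (measurable_powR (-1))).
pose h x := if B x then q x else 0.
have mh : cmeasurable h.
  have [qR qI] := mq; split.
    rewrite (_ : (fun x => _) = (fun x => if B x then complex.Re (q x) else 0)).
      exact: measurable_fun_ifT.
    by apply/funext => x; rewrite /h; case: (B x).
  rewrite (_ : (fun x => _) = (fun x => if B x then complex.Im (q x) else 0)).
    exact: measurable_fun_ifT.
  by apply/funext => x; rewrite /h; case: (B x).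
have Lh : Lp h.
  apply: (cLp_le p1 (normr_ge0 s) mh Lg) => x; rewrite /h; case: (B x).
    exact: cmod_perturbation.
  by rewrite cmod0 mulr_ge0 ?cmod_ge0.
have L0 : Lp (fun=> 0) := cLp0 mu p1.
pose F x := four_moduli p (f x) (g x) 0; pose G x := four_moduli p (f x) (g x) (h x).
have mS h' : Lp h' -> measurable_fun setT (fun x => four_moduli p (f x) (g x) (h' x)).
  move=> Lh'; have mt z : measurable_fun setT (fun x => cmod (twist f g z h' x) `^ p).
    apply: (measurableT_comp (measurable_powR p)).
    apply: measurable_cmod; apply: (@cLp_measurable _ _ _ mu p).
    by apply: cLpD; [exact: p1|apply: cLpD; [exact: p1|exact: Lf|exact: cLpZ]|exact: cLpZ].
  by apply: measurable_funD; apply: measurable_funD; exact: mt.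
have GF x : 0 <= G x <= F x.
  rewrite /G /F /h !addr_ge0 ?powR_ge0//=.
  by case: ifPn => // Bx; rewrite ltW// Hlt.
have I0 := lpn_four_twists Lf Lg L0; have Ih := lpn_four_twists Lf Lg Lh.
have IF : (\int[mu]_x (F x)%:E <= \int[mu]_x (G x)%:E)%E.
  by have := Hle h Lh; rewrite -lee_fin I0 Ih.
have Ifin : (\int[mu]_x (F x)%:E < +oo)%E.
  by rewrite -[ltLHS]I0 ltry.
have := ae_eq_integral_ge (mS _ L0) (mS _ Lh) GF IF Ifin.
apply: filterS => x FG; apply/negP => Bx.
by have := Hlt _ _ Bx; move: FG; rewrite /h /B Bx => ->; rewrite ltxx.
Qed.

Context (p2 : p != 2).
Context {A : lmodType R[i]} (mul : A -> A -> A) (star : A -> A) (nrm : A -> R).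
Context (HA : is_cstar_algebra mul star nrm).
Context (pi : A -> (T -> R[i]) -> (T -> R[i])).
Context (Hpi : isometric_Lp_rep mu p mul nrm pi).

Lemma orthogonal_disjoint a b xi eta : star a = a -> star b = b -> mul a b = 0 ->
  Lp xi -> Lp eta -> {ae mu, forall x, pi a xi x * pi b eta x = 0}.
Proof.
move=> sa sb ab Lxi Leta.
have [k k0 [s Hks]] := four_moduli_lt p1 p2.
have Lf := rep_Lp Hpi a Lxi; have Lg := rep_Lp Hpi b Leta.
(* Scaling eta by 1 / (n + 1) makes the second function small: wherever both functions are nonzero,
   some n puts the point in the excluded set. Countably many null sets cover all such points. *)
pose c n : R[i] := (n.+1%:R^-1)%:C%C.
have step n : {ae mu, forall x,
    ~~ (0 < cmod (c n * pi b eta x) ^+ 2 <= k * cmod (pi a xi x) ^+ 2)}.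
  have Ln : Lp (fun y => c n * eta y) by exact: cLpZ.
  have H := four_twists_powR p1 HA Hpi sa sb ab Lxi Ln.
  have := ae_of_four_twists Lf (rep_Lp Hpi b Ln) Hks H.
  by apply: filterS2 (rep_scale p1 Hpi b (c n) Leta) => x ->.
apply: filterS (ae_foralln step) => x Hx; apply/eqP/negPn/negP.
rewrite mulf_eq0 negb_or => /andP[f0 g0].
have cpos z : z != 0 -> 0 < cmod z ^+ 2 :> R.
  move=> z0; rewrite exprn_gt0// lt_def cmod_ge0 andbT.
  by apply: contra_neq z0 => /cmod_eq0.
have f2 := cpos _ f0; have g2 := cpos _ g0.
pose y := cmod (pi b eta x) ^+ 2 / (k * cmod (pi a xi x) ^+ 2).
have kf : 0 < k * cmod (pi a xi x) ^+ 2 by exact: mulr_gt0.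
have y0 : 0 < y by exact: divr_gt0.
pose n := Num.bound y; have yn := archi_boundP (ltW y0).
have /negP := Hx n; apply; rewrite cmodM exprMn cmod_real ger0_norm ?invr_ge0//.
have n1 : 0 < n.+1%:R :> R by rewrite ltr0n.
have i2 : 0 < n.+1%:R^-1 ^+ 2 :> R by rewrite exprn_gt0// invr_gt0.
rewrite (mulr_gt0 i2 g2) /=.
have le1 : n%:R <= n.+1%:R :> R by rewrite ler_nat.
have le2 : n.+1%:R <= n.+1%:R ^+ 2 :> R.
  by rewrite -[leLHS]mulr1 expr2 ler_pM2l// ler1n.
rewrite exprVn ler_pdivrMl ?(exprn_gt0 _ n1)// -ler_pdivrMr ?kf// -/y.
exact: le_trans (ltW yn) (le_trans le1 le2).
Qed.

Lemma rep_eq0 a : (forall f, Lp f -> {ae mu, forall x, pi a f x = 0}) -> a = 0.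
Proof.
move=> H.
have nrm_eq0 : nrm a = 0 -> a = 0 by case: HA => _ [[/(_ a)]].
apply: nrm_eq0; apply/eqP; rewrite eq_le (cstar_nrm_ge0 HA) andbT.
rewrite -lee_fin; case: Hpi => _ _ _ <-; apply: ge_ereal_sup => _ [f [Lf _] <-].
rewrite (lpnE (rep_Lp Hpi a Lf)) (lpn_ae (rep_Lp Hpi a Lf) (cLp0 mu p1) (H f Lf)).
rewrite (_ : (fun=> 0) = (fun x => 0 * (fun=> 0) x)).
  by rewrite (lpnZ p1)// ?cmod0 ?mul0r//; exact: cLp0.
by apply/funext => y; rewrite mul0r.
Qed.

Lemma rep_reduced x : mul x x = 0 -> x = 0.
Proof.
move=> /(nilpotent_cone HA)[y [s [t [a [b [[ss st s_t tt_x] [sa sb ab ay by']]]]]]].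
apply: tt_x; apply: rep_eq0 => eta Leta.
have Lz := rep_Lp Hpi y Leta.
have Vt : {ae mu, forall z, pi (mul t t) eta z = pi t (pi t eta) z}.
  exact: (rep_mul Hpi t t Leta).
have E1 := orthogonal_disjoint ss st s_t Lz (rep_Lp Hpi t Leta).
have E2 := orthogonal_disjoint ss st s_t (rep_Lp Hpi s Lz) (rep_Lp Hpi t Leta).
have E3 := orthogonal_disjoint sa sb ab Lz Lz.
have U1 := rep_mul Hpi s y Leta.
have U2 : {ae mu, forall z, pi (mul s (mul s y)) eta z = pi s (pi s (pi y eta)) z}.
  have h := rep_ae Hpi s (rep_Lp Hpi (mul s y) Leta) (rep_Lp Hpi s Lz) U1.
  by apply: filterS2 (rep_mul Hpi s (mul s y) Leta) h => z ->.
have A1 : {ae mu, forall z, pi a (pi y eta) z =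
    pi s (pi y eta) z + pi t (pi t eta) z}.
  have := rep_comb Hpi 1 (mul s y) (mul t t) Leta; rewrite scale1r -ay => h.
  apply: filterS3 (filterI h (rep_mul Hpi a y Leta)) U1 Vt => z [h1 h2] h3 h4.
  by rewrite -h2 h1 mul1r h3 h4.
have B1 : {ae mu, forall z, pi b (pi y eta) z =
    pi s (pi s (pi y eta)) z - pi t (pi t eta) z}.
  have := rep_comb Hpi (-1) (mul t t) (mul s (mul s y)) Leta.
  rewrite scaleN1r addrC -by' => h.
  apply: filterS3 (filterI h (rep_mul Hpi b y Leta)) U2 Vt => z [h1 h2] h3 h4.
  by rewrite -h2 h1 h3 h4 mulN1r addrC.
apply: filterS3 (filterI Vt (filterI A1 B1)) (filterI E1 E2) E3.
move=> z [-> [-> ->]] [e1 e2] e3.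
set u := pi s (pi y eta) z in e1 e3; set v := pi t (pi t eta) z in e1 e2 e3 *.
set u2 := pi s _ z in e2 e3.
(* Expanding (u + v) (u2 - v) = 0 with u v = u2 v = 0 gives u u2 = v^2; multiplication by v yields
   v^3 = u u2 v = 0. *)
have : v ^+ 3 = 0.
  transitivity (v * (u * u2 - u * v + u2 * v) - v * ((u + v) * (u2 - v))).
    by ring.
  rewrite e3 e1 e2 subr0 addr0 mulr0 subr0 mulrCA -[v * u2]mulrC e2.
  exact: mulr0.
by move/eqP; rewrite expf_eq0 => /andP[_ /eqP].
Qed.

End Disjointness.

Local Close Scope classical_set_scope.
Unset Implicit Arguments.

Theorem theorem5p3 (R : realType) (A : lmodType R[i])
    (mul : A -> A -> A) (star : A -> A) (nrm : A -> R)
    (HA : is_cstar_algebra mul star nrm) (p : R) (hp1 : 1 <= p) (hp2 : p != 2) :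
  has_isometric_Lp_rep p mul nrm <-> commutative_alg mul.
Proof.
split; last exact: (commutative_has_rep HA hp1).
move=> [d [T [mu [pi Hpi]]]].
exact: (reduced_commutative HA (rep_reduced hp1 hp2 HA Hpi)).
Qed.
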